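(* Let $\mathscr{G}=(\Gamma_1,\ldots,\Gamma_n)$ be a collection of $n$ diagrams in $\mathbb{R}^n$ with $[\Gamma_1,\ldots,\Gamma_n]_0<\infty$. For $I\subseteq[n]$ let $\mathcal{N}^I_{\mathscr{G}}=\{j\in[n]:\Gamma_j\cap\mathbb{R}^I\ne\emptyset\}$ and let $\mathcal{N}_{\mathscr{G}}=\{I\subseteq[n]:I\ne\emptyset,\ |\mathcal{N}^I_{\mathscr{G}}|=|I|\}$. Let $f_1,\ldots,f_n\in\mathbb{K}[x_1,\ldots,x_n]$ be polynomials such that the Newton diagram of $f_j$ is $\Gamma_j$ for each $j$. Then the following are equivalent: (1) $f_1|_{\mathbb{K}^I},\ldots,f_n|_{\mathbb{K}^I}$ are BKK non-degenerate at the origin for every non-empty subset $I$ of $[n]$ (that is, $f_1,\ldots,f_n$ are $\mathscr{G}$-non-degenerate). (2) $f_1|_{\mathbb{K}^I},\ldots,f_n|_{\mathbb{K}^I}$ are BKK non-degenerate at the origin for every $I\in\mathcal{N}_{\mathscr{G}}$.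
   Context: $\mathbb{K}$ is an algebraically closed field of arbitrary characteristic, $n\ge1$, $[n]=\{1,\ldots,n\}$. The Newton polytope of a polynomial is the convex hull of its support; its Newton diagram is the union of the compact faces of $(\mathbb{R}_{\ge0})^n+(\text{Newton polytope})$; a diagram is the Newton diagram of some polynomial. For $k=\mathbb{K}$ or $\mathbb{R}$, $k^I=\{x\in k^n:x_i=0\text{ for }i\notin I\}$; $f|_{\mathbb{K}^I}\in\mathbb{K}[x_i:i\in I]$ is $f$ with $x_i=0$ for $i\notin I$. $[\Gamma_1,\ldots,\Gamma_n]_0$ is the minimum, over polynomials $g_1,\ldots,g_n$ with Newton diagrams $\Gamma_1,\ldots,\Gamma_n$, of $\dim_{\mathbb{K}}\mathbb{K}[[x_1,\ldots,x_n]]/\langle g_1,\ldots,g_n\rangle$. Polynomials $g_1,\ldots,g_n\in\mathbb{K}[x_i:i\in I]$ are BKK non-degenerate at the origin if for every weighted order $\nu$ on $\mathbb{K}[x_i:i\in I]$ with positive integer weights $(\nu_i)_{i\in I}$ of gcd $1$, the initial forms $\mathrm{In}_\nu(g_1),\ldots,\mathrm{In}_\nu(g_n)$ have no common zero in $(\mathbb{K}^* )^n$. Here $\mathrm{In}_\nu(g)$ is the sum of the terms $c_\alpha x^\alpha$ of $g$ for which $\sum\nu_i\alpha_i$ is minimal, and $\mathrm{In}_\nu(0)=0$. *)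

(* Defs.v *)
From HB Require Import structures.
From mathcomp Require Import all_boot all_order all_algebra.
(* mpoly must be imported before the MathComp-Analysis files: in the other
   order their notations clash. *)
From mathcomp Require Import mpoly.
From mathcomp Require Import boolp classical_sets functions reals ereal.
From mathcomp Require Import topology convex.

Set Implicit Arguments.
Unset Strict Implicit.
Unset Printing Implicit Defensive.

Import Order.TTheory GRing.Theory Num.Theory.
Import numFieldTopology.Exports.

Local Open Scope classical_set_scope.
Local Open Scope ring_scope.

Section NewtonDiagram.
Variables (R : realType) (n : nat).

Definition exponent_vector (m : 'X_{1..n}) : 'rV[R]_n := \row_i (m i)%:R.

Definition nonneg_orthant : set 'rV[R]_n := [set x | forall i, 0 <= x 0 i].

Definition coordinate_subspace (I : {set 'I_n}) : set 'rV[R]_n :=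
  [set x | forall i, i \notin I -> x 0 i = 0].

(* A face of a polyhedron is the locus where some linear functional attains
   its minimum; the zero functional gives P itself. *)
Definition is_face (P F : set 'rV[R]_n) : Prop :=
  exists c : 'rV[R]_n,
    F = [set x | P x /\ forall y, P y ->
                   \sum_i c 0 i * x 0 i <= \sum_i c 0 i * y 0 i].

Variable K : closedFieldType.

Definition newton_polytope (p : {mpoly K[n]}) : set 'rV[R]_n :=
  smallest (@convex_set R 'rV[R]_n)
    [set exponent_vector m | m in [set m | m \in msupp p]].

Definition newton_polyhedron (p : {mpoly K[n]}) : set 'rV[R]_n :=
  [set x + y | x in nonneg_orthant & y in newton_polytope p].

Definition newton_diagram (p : {mpoly K[n]}) : set 'rV[R]_n :=
  [set x | exists F, [/\ is_face (newton_polyhedron p) F, compact F & F x]].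

Definition is_diagram (D : set 'rV[R]_n) : Prop :=
  exists p : {mpoly K[n]}, newton_diagram p = D.

End NewtonDiagram.

Section PowerSeries.
Variables (K : closedFieldType) (n : nat).

(* The underlying vector space of K[[x_1, ..., x_n]]: a series is the family of
   its coefficients. The product of series is [psmul]; the pointwise product
   of functions is not used. *)
Definition pseries : Type := 'X_{1..n} -> K^o.
HB.instance Definition _ := GRing.Lmodule.on pseries.

Definition psmul (a b : pseries) : pseries := fun m =>
  \sum_(k : 'X_{1..n < (mdeg m).+1, (mdeg m).+1} | m == (k.1 + k.2)%MM)
     a k.1 * b k.2.

Definition ps_of_mpoly (p : {mpoly K[n]}) : pseries := fun m => p@_m.

Definition ps_ideal (g : 'I_n -> {mpoly K[n]}) : set pseries :=
  [set h | exists a : 'I_n -> pseries,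
             h = \sum_j psmul (a j) (ps_of_mpoly (g j))].

Definition quotient_basis (J : set pseries) (d : nat) (e : 'I_d -> pseries) :
    Prop :=
  (forall h, exists c : 'I_d -> K, J (h - \sum_i c i *: e i)) /\
  (forall c : 'I_d -> K, J (\sum_i c i *: e i) -> forall i, c i = 0).

Variable R : realType.

(* The dimension of pseries / J over K: the common size of its finite bases,
   and +oo = ereal_inf set0 if it has none. *)
Definition quotient_dim (J : set pseries) : \bar R :=
  ereal_inf [set (d%:R)%:E | d in
    [set d : nat | exists e : 'I_d -> pseries, quotient_basis J e]].

(* The dimensions lie in nat or equal +oo, so the infimum is a minimum. *)
Definition mult0 (D : 'I_n -> set 'rV[R]_n) : \bar R :=
  ereal_inf [set quotient_dim (ps_ideal g) | g in
    [set g : 'I_n -> {mpoly K[n]} | forall j, newton_diagram (g j) = D j]].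

End PowerSeries.

Section BKK.
Variables (K : closedFieldType) (n : nat).

(* Elements of K[x_i : i \in I] are represented as polynomials in all n
   variables in which only the x_i with i \in I occur. *)
Definition restriction (I : {set 'I_n}) (p : {mpoly K[n]}) : {mpoly K[n]} :=
  p \mPo [tuple if i \in I then 'X_i else 0 | i < n].

(* Only the values nu i with i \in I matter. *)
Definition is_weight (I : {set 'I_n}) (nu : 'I_n -> nat) : Prop :=
  (forall i, i \in I -> (0 < nu i)%N) /\ \big[gcdn/0%N]_(i in I) nu i = 1%N.

Definition mnm_weight (I : {set 'I_n}) (nu : 'I_n -> nat) (m : 'X_{1..n}) :
    nat :=
  (\sum_(i in I) nu i * m i)%N.

Definition initial_form (I : {set 'I_n}) (nu : 'I_n -> nat) (p : {mpoly K[n]}) :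
    {mpoly K[n]} :=
  \sum_(m <- msupp p |
        all (fun m' => mnm_weight I nu m <= mnm_weight I nu m')%N (msupp p))
     p@_m *: 'X_[m].

Definition bkk_nondegenerate (I : {set 'I_n}) (g : 'I_n -> {mpoly K[n]}) :
    Prop :=
  forall nu : 'I_n -> nat, is_weight I nu ->
    ~ exists x : 'I_n -> K,
        (forall i, x i != 0) /\ (forall j, (initial_form I nu (g j)).@[x] = 0).

End BKK.

Section Collection.
Variables (R : realType) (n : nat) (D : 'I_n -> set 'rV[R]_n).

Definition calNI (I : {set 'I_n}) : {set 'I_n} :=
  [set j | `[< D j `&` coordinate_subspace I !=set0 >]]%SET.

Definition calN : {set {set 'I_n}} :=
  [set I | (I != finset.set0) && (#|calNI I| == #|I|)]%SET.

End Collection.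

(* Main.v *)
From HB Require Import structures.
Require Import Defs.
From mathcomp Require Import all_boot all_order all_algebra.
From mathcomp Require Import generic_quotient ring_quotient fraction.
From mathcomp Require Import mpoly.
From mathcomp Require Import boolp classical_sets functions reals ereal.
From mathcomp Require Import topology convex.
From mathcomp Require Import zify ring lra.

Set Implicit Arguments.
Unset Strict Implicit.
Unset Printing Implicit Defensive.

Import Order.TTheory GRing.Theory Num.Theory.

Local Open Scope ring_scope.

(** Only one implication has content: a degenerate set [I] of coordinates, with
    weight [nu] and common zero [a] in the torus, must be shown to yield a
    degenerate member of [calN Gamma].  If [I] itself is not in [calN Gamma],
    some strictly larger set is degenerate, and one repeats; the process stops
    because there are finitely many coordinates.

    Degeneracy forces all [f j] to vanish at the origin.  Finite multiplicity
    then forces at least [#|I|] of the diagrams to meet the coordinate subspace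
    of [I]: otherwise fewer than [#|I|] equations would isolate the origin in
    that subspace ([enough_equations]).  A diagram meets a coordinate subspace
    exactly when the support does ([newton_diagram_meets]), so outside
    [calN Gamma] more than [#|I|] of the [f j] are nonzero on the subspace, and
    fewer than [n - #|I|] of them vanish identically on it.

    The zero [a] gives the arc [x_i = a_i t ^ nu_i] in the subspace of [I].
    Let [x_i = t ^ N z_i] for [i] outside [I], with [N] large.  The [f j] that
    vanish on the subspace become fewer than [n - #|I|] equations in the
    [n - #|I|] unknowns [z_i] over [K(t)], all satisfied at [z = 0].  By a
    dimension count ([few_equations]) the point [z = 0] is not isolated, so
    there are a field [L] over [K(t)] and a solution [z] in [L] that is not 0 but
    specializes to 0 ([variety_through_arc]).  Chevalley's extension theorem
    ([place_extension]) turns [t -> 0, z -> 0] into a [K]-valued place of [L].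

    Let [J] consist of [I] and the [i] with [z_i <> 0].  At the point
    [x], with coordinates in [L], every [f j] is infinitely small compared with
    its largest monomial: for the equations just solved it is 0, and for the
    others the initial form along the arc vanishes at [a] and [N] is large.  A place
    orders monomials and gives residues to their quotients.  On finitely many
    monomials, Fourier-Motzkin elimination realizes the order by integer weights,
    and divisibility of the multiplicative group of [K] realizes the residues by
    a torus point ([toric_specialization]).  Taking residues of [f j] divided by
    its largest monomial shows that the initial forms of the [f j] on [J] vanish
    at that torus point ([degenerate_of_place]), so [J] is degenerate. *)

(** * Local dimension *)

Section Counting.
Variables (F : fieldType) (n : nat).
Implicit Types (p q : {mpoly F[n]}) (m : 'X_{1..n}).

(** The [N]-th power of the maximal ideal of the origin, read off
    the coefficients. *)
Definition vanish (N : nat) p := forall m, (mdeg m < N)%N -> p@_m = 0.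

Lemma vanish0 N : vanish N 0.
Proof. by move=> m _; rewrite mcoeff0. Qed.

Lemma vanishD N p q : vanish N p -> vanish N q -> vanish N (p + q).
Proof. by move=> vp vq m hm; rewrite mcoeffD vp // vq // addr0. Qed.

Lemma vanishN N p : vanish N p -> vanish N (- p).
Proof. by move=> vp m hm; rewrite mcoeffN vp // oppr0. Qed.

Lemma vanish_le N N' p : (N' <= N)%N -> vanish N p -> vanish N' p.
Proof. by move=> le vp m hm; apply: vp; apply: leq_trans le. Qed.

Lemma vanishM a b p q : vanish a p -> vanish b q -> vanish (a + b) (p * q).
Proof.
move=> vp vq m hm; rewrite mcoeffM big1 // => -[k1 k2] /= /eqP km.
case: (ltnP (mdeg k1) a) => h1; first by rewrite vp // mul0r.
case: (ltnP (mdeg k2) b) => h2; first by rewrite vq // mulr0.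
have e : mdeg m = (mdeg k1 + mdeg k2)%N by rewrite {1}km mdegD.
by have := leq_add h1 h2; rewrite -e leqNgt hm.
Qed.

Lemma vanish_any p : vanish 0 p. Proof. by []. Qed.

Lemma vanishMl N p q : vanish N q -> vanish N (p * q).
Proof. by move=> vq; rewrite -[N]add0n; apply: vanishM vq; apply: vanish_any. Qed.

Lemma vanishX N k p : vanish N p -> vanish (k * N) (p ^+ k).
Proof.
move=> vp; elim: k => [|k IH]; first by rewrite mul0n; apply: vanish_any.
by rewrite exprS mulSn; apply: vanishM.
Qed.

Lemma vanish1 p : p@_0%MM = 0 -> vanish 1 p.
Proof. by move=> p0 m; rewrite ltnS leqn0 mdeg_eq0 => /eqP ->. Qed.

Lemma vanish_monomial (k : nat) (g : 'I_k -> {mpoly F[n]}) (b : 'X_{1..k}) :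
  (forall j, (g j)@_0%MM = 0) -> vanish (mdeg b) (\prod_j g j ^+ b j).
Proof.
move=> g0; rewrite mdegE.
apply: (big_ind2 (fun d q => vanish d q)) => [|d1 d2 q1 q2|j _].
- exact: vanish_any.
- exact: vanishM.
- by have := vanishX (k := b j) (vanish1 (g0 j)); rewrite muln1.
Qed.

(** A truncated geometric series inverts a polynomial with nonzero constant
    term up to order [N]. *)
Lemma unit_mod_vanish N p : p@_0%MM != 0 -> exists q, vanish N (q * p - 1).
Proof.
move=> p0; pose c := (p@_0%MM)^-1; pose u := 1 - c *: p.
have vu : vanish 1 u.
  by apply: vanish1; rewrite mcoeffB mcoeff1 eqxx mcoeffZ mulVf // subrr.
exists (c *: \sum_(i < N) u ^+ i).
have -> : c *: (\sum_(i < N) u ^+ i) * p - 1 = - u ^+ N.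
  have -> : c *: (\sum_(i < N) u ^+ i) * p = (1 - u) * \sum_(i < N) u ^+ i.
    have cu : 1 - u = c *: p by rewrite subKr.
    by rewrite cu -scalerAl scalerAr mulrC.
  by rewrite -[1 - u]opprB mulNr -subrX1 opprB addrAC subrr add0r.
by apply: vanishN; have := vanishX (k := N) vu; rewrite muln1.
Qed.

(** By Krull's intersection theorem this is membership in the ideal generated
    by [g] in the local ring of the origin, or equally in the power series
    ring; approximation to every order avoids constructing either ring. *)
Definition locally_in_ideal (k : nat) (g : 'I_k -> {mpoly F[n]}) p :=
  forall N, exists q : 'I_k -> {mpoly F[n]}, vanish N (p - \sum_j q j * g j).

Definition boxm (r : nat) (e : {ffun 'I_n -> 'I_r}) : 'X_{1..n} :=
  [multinom (e i : nat) | i < n].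

Section Span.
Variables (k r N : nat) (g : 'I_k -> {mpoly F[n]}).
Hypothesis g0 : forall j, (g j)@_0%MM = 0.
Hypothesis powers : forall i, exists q : 'I_k -> {mpoly F[n]},
  vanish N ('X_i ^+ r - \sum_j q j * g j).

(** Modulo the [g j], a monomial outside the box can be rewritten through the
    power ['X_i ^+ r] that it contains. *)
Lemma box_reduction p : exists (c : {ffun 'I_n -> 'I_r} -> F)
    (q : 'I_k -> {mpoly F[n]}),
  vanish N (p - \sum_e c e *: 'X_[boxm e] - \sum_j q j * g j).
Proof.
elim/mpolyind: p => [|a m p _ _ [c [q vp]]].
  exists (fun=> 0), (fun=> 0); rewrite !big1 ?subr0; first exact: vanish0.
    by move=> i _; rewrite mul0r.
  by move=> i _; rewrite scale0r.
case: (boolP [forall i, (m i < r)%N]) => [/forallP mr|].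
  pose e0 : {ffun 'I_n -> 'I_r} := [ffun i => Ordinal (mr i)].
  have e0m : boxm e0 = m by apply/mnmP => i; rewrite mnmE ffunE.
  exists (fun e => c e + (if e == e0 then a else 0)), q.
  have -> : \sum_e (c e + (if e == e0 then a else 0)) *: 'X_[boxm e]
          = \sum_e c e *: 'X_[boxm e] + a *: 'X_[m] :> {mpoly F[n]}.
    under eq_bigr do rewrite scalerDl.
    rewrite big_split /=; congr (_ + _).
    rewrite (bigD1 e0) //= eqxx e0m big1 ?addr0 // => e /negPf ->.
    by rewrite scale0r.
  by rewrite [a *: _ + p]addrC opprD addrACA subrr addr0.
rewrite negb_forall => /existsP[i]; rewrite -leqNgt => ri.
have [q' v'] := powers i.
exists c, (fun j => q j + a *: 'X_[m - U_(i) *+ r] * q' j).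
under [X in _ - X]eq_bigr do rewrite mulrDl -mulrA.
rewrite big_split -mulr_sumr /=.
have -> : 'X_[m] = 'X_[m - U_(i) *+ r] * 'X_i ^+ r :> {mpoly F[n]}.
  rewrite mpolyXn -mpolyXD submK //; apply/mnm_lepP => j.
  by rewrite mulmnE mnm1E; case: eqP => [<-|_]; rewrite ?mul1n.
set A := \sum_e _; set B := \sum_j _; set C := \sum_j _.
have -> : a *: ('X_[(m - U_(i) *+ r)] * 'X_i ^+ r) + p - A -
    (B + a *: 'X_[(m - U_(i) *+ r)] * C) = (p - A - B) +
    (a *: 'X_[(m - U_(i) *+ r)]) * ('X_i ^+ r - C).
  rewrite scalerAl; ring.
by apply: vanishD => //; apply: vanishMl.
Qed.

Local Notation idx := ({ffun 'I_k -> 'I_N} * {ffun 'I_n -> 'I_r})%type.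

Definition spanning_vector (b : idx) : {mpoly F[n]} :=
  'X_[boxm b.2] * \prod_j g j ^+ b.1 j.

Definition in_span p := exists c : idx -> F,
  vanish N (p - \sum_b c b *: spanning_vector b).

Lemma in_span_vanish p : vanish N p -> in_span p.
Proof.
move=> vp; exists (fun=> 0); rewrite big1 ?subr0 // => b _; exact: scale0r.
Qed.

Lemma in_spanD p q : in_span p -> in_span q -> in_span (p + q).
Proof.
move=> [c1 v1] [c2 v2]; exists (fun b => c1 b + c2 b).
under eq_bigr do rewrite scalerDl.
by rewrite big_split /= opprD addrACA; apply: vanishD.
Qed.

Lemma in_span_sum (I : Type) (s : seq I) (G : I -> {mpoly F[n]}) :
  (forall i, in_span (G i)) -> in_span (\sum_(i <- s) G i).
Proof.
move=> H; apply: big_ind => //; [|move=> *; exact: in_spanD].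
by apply: in_span_vanish; apply: vanish0.
Qed.

Lemma in_span_vector a b : in_span (a *: spanning_vector b).
Proof.
exists (fun b' => if b' == b then a else 0).
rewrite (bigD1 b) //= eqxx big1 ?addr0 ?subrr; first exact: vanish0.
by move=> b' /negPf ->; rewrite scale0r.
Qed.

(** Box reduction of [p], then of the coefficients of the [g j], and so on,
    expands [p] in products of the [g j] with coefficients in the box.  Each
    round raises the order of the remainder, since the [g j] have no constant
    term, so the expansion stops at order [N]. *)
Lemma spanning_aux d (b : 'X_{1..k}) p :
  (N <= mdeg b + d)%N -> in_span (p * \prod_j g j ^+ b j).
Proof.
elim: d b p => [|d IH] b p hN.
  apply: in_span_vanish; apply: vanishMl; apply: vanish_le (vanish_monomial g0).
  by rewrite addn0 in hN.
case: (ltnP (mdeg b) N) => hb; last first.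
  by apply: in_span_vanish; apply: vanishMl; apply: vanish_le (vanish_monomial g0).
have [c [q v]] := box_reduction p.
have pE : p = p - \sum_e c e *: 'X_[boxm e] - \sum_j q j * g j
    + \sum_j q j * g j + \sum_e c e *: 'X_[boxm e] by rewrite !subrK.
rewrite pE 2!mulrDl; apply: in_spanD.
  apply: in_spanD.
    by apply: in_span_vanish; rewrite mulrC; apply: vanishMl.
  rewrite mulr_suml; apply: in_span_sum => j.
  have -> : q j * g j * \prod_i g i ^+ b i =
      q j * \prod_i g i ^+ (U_(j) + b)%MM i.
    rewrite -mulrA; congr (_ * _).
    under [RHS]eq_bigr do rewrite mnmDE mnm1E exprD.
    rewrite big_split /=; congr (_ * _).
    rewrite (bigD1 j) //= eqxx expr1 big1 ?mulr1 // => i ij.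
    by rewrite eq_sym (negPf ij) expr0.
  by apply: IH; rewrite mdegD mdeg1 add1n addSnnS.
rewrite mulr_suml; apply: in_span_sum => e.
have hbj j : (b j < N)%N.
  by apply: leq_ltn_trans hb; rewrite mdegE (bigD1 j) //= leq_addr.
pose b' : idx := ([ffun j => Ordinal (hbj j)], e).
suff -> : c e *: 'X_[boxm e] * \prod_j g j ^+ b j = c e *: spanning_vector b'
  by exact: in_span_vector.
rewrite /spanning_vector scalerAl; congr (_ * _).
by apply: eq_bigr => j _; rewrite ffunE.
Qed.

Lemma spanning p : in_span p.
Proof.
have := @spanning_aux N 0%MM p; rewrite mdeg0 => /(_ (leqnn _)).
by under eq_bigr do rewrite mnm0E expr0; rewrite big1 // mulr1.
Qed.

(** The [M ^ n] monomials with all exponents below [M] are independent up to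
    order [n * M], and they are combinations of [N ^ k * r ^ n] vectors: the
    identity matrix of size [M ^ n] factors through that dimension. *)
Lemma box_count M : (0 < n)%N -> (0 < M)%N -> N = (n * M)%N ->
  (M ^ n <= N ^ k * r ^ n)%N.
Proof.
move=> n0 M0 NE.
pose I1 := {ffun 'I_n -> 'I_M}.
have [C CE] := choice (fun a : I1 => spanning 'X_[boxm a]).
pose A := \matrix_(i < #|{: I1}|, j < #|{: idx}|) C (enum_val i) (enum_val j).
pose B := \matrix_(j < #|{: idx}|, i < #|{: I1}|)
  (spanning_vector (enum_val j))@_(boxm (enum_val i)).
have degbox (a : I1) : (mdeg (boxm a) < N)%N.
  rewrite mdegE NE; apply: (@leq_ltn_trans (\sum_(i < n) M.-1)%N).
    by apply: leq_sum => i _; rewrite mnmE -ltnS prednK.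
  by rewrite sum_nat_const card_ord ltn_pmul2l // prednK.
have boxm_inj : injective (@boxm M).
  move=> e1 e2 /mnmP e12; apply/ffunP => i; apply/val_inj.
  by have := e12 i; rewrite !mnmE.
have AB : A *m B = 1%:M.
  apply/matrixP => i i'; rewrite !mxE.
  have := CE (enum_val i) _ (degbox (enum_val i')).
  rewrite mcoeffB mcoeffX raddf_sum /= => /eqP; rewrite subr_eq0 => /eqP.
  rewrite (inj_eq boxm_inj) (inj_eq enum_val_inj) => ->.
  rewrite [RHS](reindex (fun j : 'I_#|{: idx}| => enum_val j)) /=; last first.
    exact/onW_bij/enum_val_bij.
  by apply: eq_bigr => j _; rewrite !mxE mcoeffZ.
have := mulmx1_min AB.
by rewrite card_prod !card_ffun !card_ord.
Qed.

End Span.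

(** The origin is not an isolated zero of fewer than [n] equations in [n]
    variables: if every variable were nilpotent in the local ring, [box_count]
    would bound [M ^ n] by a constant times [M ^ k] for all [M]. *)
Lemma few_equations (k : nat) (g : 'I_k -> {mpoly F[n]}) :
  (k < n)%N -> (forall j, (g j)@_0%MM = 0) ->
  exists i, forall s r, s@_0%MM != 0 -> ~ locally_in_ideal g (s * 'X_i ^+ r).
Proof.
move=> kn g0; apply: contrapT => /forallNP H.
have {}H i : exists sr : {mpoly F[n]} * nat,
    sr.1@_0%MM != 0 /\ locally_in_ideal g (sr.1 * 'X_i ^+ sr.2).
  have := H i; move/existsNP => [s /existsNP[r /not_implyP[s0 /contrapT h]]].
  by exists (s, r).
have [sr srP] := choice H.
pose r := (\max_i (sr i).2)%N.
have powers N i : exists q : 'I_k -> {mpoly F[n]},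
    vanish N ('X_i ^+ r - \sum_j q j * g j).
  have [s0 /(_ N)[q vq]] := srP i; have [u vu] := unit_mod_vanish N s0.
  have ri : ((sr i).2 <= r)%N by rewrite /r (bigD1 i) //= leq_maxl.
  exists (fun j => 'X_i ^+ (r - (sr i).2) * u * q j).
  under eq_bigr do rewrite -mulrA.
  rewrite -mulr_sumr.
  set S := \sum_j _ in vq *; set s := (sr i).1 in vq vu.
  have -> : 'X_i ^+ r - 'X_i ^+ (r - (sr i).2) * u * S =
     'X_i ^+ (r - (sr i).2) * u * (s * 'X_i ^+ (sr i).2 - S)
     + (- 'X_i ^+ r) * (u * s - 1).
    have -> : 'X_i ^+ r = 'X_i ^+ (r - (sr i).2) * 'X_i ^+ (sr i).2
      :> {mpoly F[n]} by rewrite -exprD subnK.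
    ring.
  by apply: vanishD; apply: vanishMl.
(* Large enough that [M ^ n] exceeds [(n * M) ^ k * r ^ n], as [k < n]. *)
pose M := (n ^ k * r ^ n).+1.
have n0 : (0 < n)%N by apply: leq_ltn_trans kn.
have := box_count g0 (powers (n * M)%N) n0 (ltn0Sn _ : 0 < M)%N erefl.
apply/negP; rewrite -ltnNge expnMn.
apply: (@leq_trans (M ^ k.+1)); last exact: leq_pexp2l.
by rewrite expnS mulnAC ltn_pmul2r ?expn_gt0.
Qed.

End Counting.

(** * Prime ideals and generic points *)

Section ZornAbove.
Local Open Scope classical_set_scope.

(** Zorn's lemma for families closed under unions of nonempty chains.  Adjoining
    [X0] to every member makes the empty chain harmless and keeps the maximal
    element above [X0]. *)
Lemma Zorn_above (T : Type) (P : set (set T)) (X0 : set T) : P X0 ->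
  (forall C : set (set T), C !=set0 -> C `<=` P -> total_on C subset ->
     P (\bigcup_(X in C) X)) ->
  exists A, [/\ P A, X0 `<=` A & forall B, A `<=` B -> P B -> B `<=` A].
Proof.
move=> PX0 Pchain.
have [A [PA Amax]] :
    exists A, P (A `|` X0) /\ forall B, A `<` B -> ~ P (B `|` X0).
  apply: (@Zorn_bigcup _ [set X | P (X `|` X0)]) => C CP Ctot /=.
  have [C0|Cne] := pselect (C !=set0); last first.
    suff -> : \bigcup_(X in C) X `|` X0 = X0 by [].
    apply/setUidPr => x [X CX _]; case: Cne; exists X; exact: CX.
  have -> : \bigcup_(X in C) X `|` X0 = \bigcup_(Y in [set X `|` X0 | X in C]) Y.
    rewrite bigcup_image eqEsubset; split => x.
      case=> [[X CX Xx]|X0x]; first by exists X => //; left.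
      by have [X CX] := C0; exists X => //; right.
    by case=> X CX [Xx|X0x]; [left; exists X | right].
  apply: Pchain.
  - by have [X CX] := C0; exists (X `|` X0); exists X.
  - by move=> _ [X CX <-]; exact: CP.
  - move=> _ _ [X CX <-] [Y CY <-].
    by have [XY|YX] := Ctot _ _ CX CY; [left|right] => z [];
      [move/XY; left | right | move/YX; left | right].
exists (A `|` X0); split; [exact: PA | by move=> x; right |].
move=> B AB PB; have BX0 : B `|` X0 = B by apply/setUidPl => x X0x; apply: AB; right.
apply: contrapT => nBA; apply: (Amax B); rewrite ?BX0 //; split.
  by move=> x Ax; apply: AB; left.
by move=> BA; apply: nBA => x /BA Ax; left.
Qed.

End ZornAbove.

Section PrimeAvoidance.
Local Open Scope classical_set_scope.
Local Open Scope quotient_scope.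
Variable T : comNzRingType.
Implicit Types X J M : set T.

Definition ideal_set X :=
  [/\ X 0, forall x y, X x -> X y -> X (x + y) & forall a x, X x -> X (a * x)].

(** An ideal maximal among those that avoid a multiplicative set is prime. *)
Lemma prime_avoiding J M : ideal_set J -> M 1 ->
  (forall x y, M x -> M y -> M (x * y)) -> (forall x, M x -> ~ J x) ->
  exists P, [/\ ideal_set P, J `<=` P, forall x, M x -> ~ P x &
    forall x y, P (x * y) -> P x \/ P y].
Proof.
move=> [J0 JD JM] M1 MM MJ.
pose good X := ideal_set X /\ forall x, M x -> ~ X x.
have [P [[[P0 PD PM] Pdisj] JP Pmax]] : exists P,
    [/\ good P, J `<=` P & forall B, P `<=` B -> good B -> B `<=` P].
  apply: Zorn_above => // C [Z CZ] Cgood Ctot; split; last first.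
    by move=> x Mx [X CX Xx]; have [_ /(_ x Mx)] := Cgood _ CX.
  split.
  - by exists Z => //; have [[]] := Cgood _ CZ.
  - move=> x y [X CX Xx] [Y CY Yy].
    have [XY|YX] := Ctot _ _ CX CY; [exists Y | exists X] => //.
      by have [[_ ZD _] _] := Cgood _ CY; apply: ZD => //; apply: XY.
    by have [[_ ZD _] _] := Cgood _ CX; apply: ZD => //; apply: YX.
  - move=> a x [X CX Xx]; exists X => //.
    by have [[_ _ ZM] _] := Cgood _ CX; apply: ZM.
have meet x : ~ P x -> exists t p, P p /\ M (p + t * x).
  move=> nPx; pose B := [set z | exists t p, P p /\ z = p + t * x].
  apply: contrapT => nex; apply: nPx; apply: (Pmax B); last first.
  - by exists 1, 0; rewrite add0r mul1r.
  - split; last first.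
      by move=> z Mz [t [p [Pp zE]]]; apply: nex; exists t, p; rewrite -zE.
    split.
    + by exists 0, 0; rewrite mul0r addr0.
    + move=> _ _ [t1 [p1 [P1 ->]]] [t2 [p2 [P2 ->]]].
      exists (t1 + t2), (p1 + p2); split; first exact: PD.
      by rewrite mulrDl addrACA.
    + move=> a _ [t [p [Pp ->]]]; exists (a * t), (a * p); split; first exact: PM.
      by rewrite mulrDr mulrA.
  - by move=> z Pz; exists 0, z; split; rewrite // mul0r addr0.
exists P; split => //.
move=> x y Pxy; apply: contrapT => /not_orP[nx ny].
have [t1 [p1 [P1 M1']]] := meet _ nx; have [t2 [p2 [P2 M2']]] := meet _ ny.
apply: (Pdisj _ (MM _ _ M1' M2')).
have -> : (p1 + t1 * x) * (p2 + t2 * y) =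
   (p2 + t2 * y) * p1 + (t1 * x * p2 + t1 * t2 * (x * y)) by ring.
by apply: (PD); [exact: PM | apply: PD; exact: PM].
Qed.

(** [L] is the fraction field of the quotient by [P]; the inverses that make the
    quotient a unit ring are chosen classically. *)
Lemma field_of_prime P : ideal_set P -> ~ P 1 ->
    (forall x y, P (x * y) -> P x \/ P y) ->
  exists (L : fieldType) (pi : {rmorphism T -> L}), forall x, pi x = 0 <-> P x.
Proof.
move=> [P0 PD PM] P1 Pprime.
pose p : T -> bool := fun x => `[< P x >].
have pE x : (x \in p) = `[< P x >] by [].
have idp : idealr_closed p.
  split; rewrite ?pE; [exact/asboolP | exact/asboolPn |].
  move=> a x y; rewrite !pE => /asboolP Px /asboolP Py.
  by apply/asboolP/PD => //; apply: PM.
have prp : prime_idealr_closed p.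
  move=> x y; rewrite !pE => /asboolP /Pprime[]/asboolP -> //.
  by rewrite orbT.
pose I : prime_idealr T := HB.pack p (isIdealr.Build T p idp)
  (isPrimeIdealrClosed.Build T p prp).
pose Q : comNzRingType := {ideal_quot I}.
pose un : pred Q := fun x => `[< exists y, y * x = 1 >].
pose iv : Q -> Q := fun x =>
  match pselect (exists y, y * x = 1) with
  | left e => proj1_sig (cid e) | right _ => x end.
have mulVx : {in un, left_inverse 1 iv *%R}.
  move=> x /asboolP ex; rewrite /iv; case: pselect => // e.
  by case: (cid e).
have unitPl x y : y * x = 1 -> un x by move=> yx; apply/asboolP; exists y.
have invN : {in [predC un], iv =1 id}.
  move=> x; rewrite inE => /asboolPn nex; rewrite /iv; case: pselect => //.
pose U : comUnitRingType := HB.pack Q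
  (GRing.ComNzRing_hasMulInverse.Build Q mulVx unitPl invN).
pose D : idomainType := HB.pack U
  (GRing.ComUnitRing_isIntegral.Build U (@Quotient.rquot_IdomainAxiom T I)).
pose pi : T -> {fraction D} := fun x => tofrac ((\pi_Q x : Q) : D).
have pi_add : zmod_morphism pi.
  by move=> x y; rewrite /pi !rmorphB.
have pi_mul : monoid_morphism pi.
  by split=> [|x y]; rewrite /pi ?rmorph1 ?rmorphM.
pose pi' : {rmorphism T -> {fraction D}} := HB.pack pi
  (GRing.isZmodMorphism.Build _ _ pi pi_add)
  (GRing.isMonoidMorphism.Build _ _ pi pi_mul).
exists {fraction D}, pi' => x.
suff : (pi x == 0) = p x.
  by move=> e; split => [/eqP|Px]; [rewrite e => /asboolP | apply/eqP; rewrite e; apply/asboolP].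
rewrite /pi tofrac_eq0 -[0 in LHS](rmorph0 \pi_Q).
by rewrite -Quotient.idealrBE subr0.

Qed.

End PrimeAvoidance.

(** * Places *)

Section Places.
Local Open Scope classical_set_scope.
Variables (L : fieldType) (K : closedFieldType).
Implicit Types (G : set (L * K)) (x y : L) (c d : K).

(** [G] is the graph of a ring morphism to [K] from a subring of [L].  Graphs
    are ordered by inclusion, which suits Zorn's lemma. *)
Definition partial_place G :=
  [/\ G (1, 1),
      forall x y c d, G (x, c) -> G (y, d) -> G (x - y, c - d),
      forall x y c d, G (x, c) -> G (y, d) -> G (x * y, c * d) &
      forall c, G (0, c) -> c = 0].

(** The subring is a valuation ring.  A point sent to infinity is one whose
    inverse has residue 0. *)
Definition place G :=
  partial_place G /\ forall x, x != 0 -> (exists c, G (x, c)) \/ G (x^-1, 0).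

Section Maximal.
Variables (G : set (L * K)) (iota : {rmorphism K -> L}).
Hypotheses (Gp : partial_place G) (Gi : forall c, G (iota c, c)).
Hypothesis Gmax : forall H, G `<=` H -> partial_place H -> H `<=` G.

Let GB : forall x y c d, G (x, c) -> G (y, d) -> G (x - y, c - d).
Proof. by case: Gp. Qed.
Let GM : forall x y c d, G (x, c) -> G (y, d) -> G (x * y, c * d).
Proof. by case: Gp. Qed.
Let Gfun : forall c, G (0, c) -> c = 0.
Proof. by case: Gp. Qed.

Let G1 : G (1, 1).
Proof. by case: Gp. Qed.

Let G0 : G (0, 0).
Proof. by have := GB G1 G1; rewrite !subrr. Qed.

Let GD x y c d : G (x, c) -> G (y, d) -> G (x + y, c + d).
Proof.
by move=> Gx Gy; have := GB Gx (GB G0 Gy); rewrite !sub0r !opprK.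
Qed.

Let Gsum (I : Type) (s : seq I) (P : pred I) (u : I -> L) (v : I -> K) :
  (forall i, P i -> G (u i, v i)) ->
  G (\sum_(i <- s | P i) u i, \sum_(i <- s | P i) v i).
Proof.
move=> Guv; apply: (big_ind2 (fun a b => G (a, b))) => //.
by move=> *; apply: GD.
Qed.

Definition residue_poly (p : {poly L}) (q : {poly K}) :=
  forall i, G (p`_i, q`_i).

Lemma residue_polyB p q p' q' :
  residue_poly p q -> residue_poly p' q' -> residue_poly (p - p') (q - q').
Proof. by move=> h h' i; rewrite !coefB; apply: GB. Qed.

Lemma residue_polyM p q p' q' :
  residue_poly p q -> residue_poly p' q' -> residue_poly (p * p') (q * q').
Proof. by move=> h h' i; rewrite !coefM; apply: Gsum => j _; apply: GM. Qed.

Lemma residue_polyC x c : G (x, c) -> residue_poly x%:P c%:P.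
Proof. by move=> h i; rewrite !coefC; case: eqP. Qed.

Lemma residue_polyXn n : residue_poly 'X^n 'X^n.
Proof. by move=> i; rewrite !coefXn; case: eqP. Qed.

Lemma residue_poly_map q : residue_poly (map_poly iota q) q.
Proof. by move=> i; rewrite coef_map; apply: Gi. Qed.

(** By maximality no value can be assigned to [x], so for every [c] some
    relation satisfied by [x] reduces to a polynomial that does not vanish at
    [c].  The reductions of relations form an ideal of the polynomial ring of
    [K] without common root, hence contain 1. *)
Lemma not_residue_relation x : ~ (exists c, G (x, c)) ->
  exists p, residue_poly p 1 /\ p.[x] = 0.
Proof.
move=> nx.
pose a q := exists p, residue_poly p q /\ p.[x] = 0.
have extend c : exists q, a q /\ q.[c] != 0.
  apply: contrapT => nq; apply: nx; exists c.
  (* The graph obtained by sending [x] to [c]. *)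
  pose H := [set z : L * K | exists p q,
    residue_poly p q /\ z = (p.[x], q.[c])].
  apply: (Gmax (H := H)).
  - move=> [y d] Gy; exists y%:P, d%:P; rewrite !hornerC; split => //.
    exact: residue_polyC.
  - split.
    + by exists 1, 1; rewrite !hornerC; split => //; apply: residue_polyC.
    + move=> _ _ _ _ [p [q [h [-> ->]]]] [p' [q' [h' [-> ->]]]].
      exists (p - p'), (q - q'); rewrite !hornerD !hornerN; split => //.
      exact: residue_polyB.
    + move=> _ _ _ _ [p [q [h [-> ->]]]] [p' [q' [h' [-> ->]]]].
      exists (p * p'), (q * q'); rewrite !hornerM; split => //.
      exact: residue_polyM.
    + move=> d [p [q [h [p0 ->]]]]; apply/eqP; apply: contrapT => /negP q0.
      by apply: nq; exists q; split => //; exists p.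
  - exists 'X, 'X; rewrite !hornerX; split => //.
    exact: (residue_polyXn 1).
have [q0 [aq0 q0c]] := extend 0.
have q0n : q0 != 0 by apply: contraNneq q0c => ->; rewrite horner0.
have exk : exists k, `[< exists q, [/\ a q, q != 0 & size q = k] >].
  by exists (size q0); apply/asboolP; exists q0.
case: (ex_minnP exk) => k /asboolP[q [aq qn qk]] kmin.
have divides q' : a q' -> q %| q'.
  move=> [p' [h' p'x]]; have [p [h px]] := aq.
  rewrite /dvdp; apply: contrapT => /negP rn.
  have : (k <= size (q' %% q)%R)%N.
    apply: kmin; apply/asboolP; exists (q' %% q); split => //.
    exists (p' - map_poly iota (q' %/ q) * p); split.
      have -> : q' %% q = q' - q' %/ q * q.
        by apply/eqP; rewrite eq_sym subr_eq addrC -divp_eq.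
      by apply: residue_polyB => //; apply: residue_polyM => //; apply: residue_poly_map.
    by rewrite hornerD hornerN hornerM p'x px mulr0 subrr.
  by rewrite -qk leqNgt ltn_modp qn.
case: (eqVneq (size q) 1%N) => [q1|q1]; last first.
  have /closed_rootP[c rc] := q1.
  have [q' [/divides qq' nr]] := extend c.
  by case/negP: nr; rewrite -[_ == 0]dvdp_XsubCl (dvdp_trans _ qq') ?dvdp_XsubCl.
have [b b0 qb] : exists2 b, b != 0 & q = b%:P.
  by apply/size_poly1P; rewrite q1.
have [p [h px]] := aq.
exists ((iota b^-1)%:P * p); split; last by rewrite hornerM px mulr0.
suff -> : 1 = (b^-1)%:P * q by apply: residue_polyM => //; apply: residue_polyC.
by rewrite qb -polyCM mulVf.
Qed.

(** A relation for the inverse of [x] that reduces to 1, multiplied by a power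
    of [x], would make a power of [c] the residue of 0. *)
Lemma residue_inv x c : G (x, c) -> c != 0 -> G (x^-1, c^-1).
Proof.
move=> Gx c0.
have x0 : x != 0.
  by apply: contraNneq c0 => x0; rewrite x0 in Gx; rewrite (Gfun Gx).
have [[d Gd]|/not_residue_relation[p [h px]]] := pselect (exists d, G (x^-1, d)).
  suff -> : c^-1 = d by [].
  apply: (mulfI c0); rewrite divff //; apply/eqP; rewrite -subr_eq0; apply/eqP.
  by apply: Gfun; rewrite -(subrr (1 : L)) -{2}(divff x0); apply: GB => //; apply: GM.
exfalso.
pose n := (size p).-1.
suff : c ^+ n = 0 by move/eqP; rewrite expf_eq0 (negPf c0) andbF.
apply: Gfun.
have -> : 0 = \sum_(i < size p) p`_i * x ^+ (n - i).
  transitivity (x ^+ n * p.[x^-1]); first by rewrite px mulr0.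
  rewrite horner_coef mulr_sumr.
  apply: eq_bigr => i _; rewrite mulrCA; congr (_ * _).
  have hi : (i <= n)%N by rewrite -ltnS (leq_trans (ltn_ord i)) ?leqSpred.
  by rewrite -{1}(subnK hi) exprD -mulrA -exprMn divff // expr1n mulr1.
have -> : c ^+ n = \sum_(i < size p) (1 : {poly K})`_i * c ^+ (n - i).
  have p0 : (0 < size p)%N.
    rewrite lt0n size_poly_eq0; apply/eqP => p0.
    have := h 0%N; rewrite p0 coef0 coef1 => /Gfun /eqP; exact/negP/oner_neq0.
  rewrite (bigD1 (Ordinal p0)) //= coef1 mul1r subn0 big1 ?addr0 // => i.
  by rewrite -val_eqE /= coef1 => /negPf ->; rewrite mul0r.
apply: Gsum => i _; apply: GM => //.
elim: (n - i)%N => [|k IH]; first by rewrite !expr0.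
by rewrite !exprS; apply: GM.
Qed.

(** The relation of lower degree, reversed so that it becomes a relation for the
    inverse, removes the leading term of the other one without changing its
    reduction 1.  Both degrees cannot decrease forever. *)
Lemma no_two_relations k x y (p p' : {poly L}) : x * y = 1 ->
  (size p + size p' <= k)%N -> residue_poly p 1 -> p.[x] = 0 ->
  residue_poly p' 1 -> p'.[y] = 0 -> False.
Proof.
elim: k x y p p' => [|k IH] x y p p' xy; last first.
  wlog le : x y p p' xy / (size (p' : {poly L}) <= size (p : {poly L}))%N.
    move=> W; case/orP: (leq_total (size p') (size p)) => le; first exact: (W x y).
    rewrite addnC => hk hp px hp' p'y.
    by apply: (W y x p' p) => //; rewrite mulrC.
  move=> hk hp px hp' p'y.
  have nz (r : {poly L}) z : residue_poly r 1 -> r.[z] = 0 -> (1 < size r)%N.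
    move=> hr rz; rewrite ltnNge; apply/negP => /size1_polyC re.
    have := hr 0%N; move: rz; rewrite re hornerC coefC eqxx => ->.
    by rewrite coef1 => /Gfun /eqP; apply/negP/oner_neq0.
  have p1 := nz _ _ hp px; have p'1 := nz _ _ hp' p'y.
  pose n := (size p).-1; pose m := (size p').-1.
  have mn : (m <= n)%N by rewrite /m /n -!subn1 leq_sub2r.
  (* The relation [p'] for [y], multiplied by [x ^ m]. *)
  pose rev := \sum_(i < size p') p'`_i *: 'X^(m - i).
  have hrev : residue_poly rev 'X^m.
    move=> j; rewrite coef_sum.
    have -> : ('X^m : {poly K})`_j =
        \sum_(i < size p') (1 : {poly K})`_i * ('X^(m - i) : {poly K})`_j.
      rewrite (bigD1 (Ordinal (ltnW p'1))) //= coef1 mul1r subn0 big1 ?addr0 // => i.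
      by rewrite -val_eqE /= coef1 => /negPf ->; rewrite mul0r.
    apply: Gsum => i _; rewrite coefZ; apply: GM => //; exact: residue_polyXn.
  have revx : rev.[x] = 0.
    transitivity (x ^+ m * p'.[y]); last by rewrite p'y mulr0.
    rewrite horner_sum horner_coef mulr_sumr.
    apply: eq_bigr => i _; rewrite hornerZ hornerXn [RHS]mulrCA; congr (_ * _).
    have hi : (i <= m)%N by rewrite -ltnS (leq_trans (ltn_ord i)) ?leqSpred.
    by rewrite -{2}(subnK hi) exprD -mulrA -exprMn xy expr1n mulr1.
  pose r := p'`_0 *: p - (p`_n *: 'X^(n - m)) * rev.
  apply: (IH x y r p') => //.
  - rewrite -ltnS; apply: leq_trans hk; rewrite ltn_add2r.
    rewrite -[ltnRHS](prednK (ltnW p1)) ltnS -/n; apply/leq_sizeP => j nj.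
    rewrite coefB coefZ -scalerAl coefZ coefXnM ltnNge.
    rewrite (leq_trans (leq_subr _ _) nj) /= coef_sum.
    have [->|jn] := eqVneq j n.
      rewrite subKn // (bigD1 (Ordinal (ltnW p'1))) //= coefZ coefXn subn0 eqxx.
      rewrite big1 ?addr0 ?mulr1; first by rewrite mulrC subrr.
      move=> i; rewrite -val_eqE /= => i0; rewrite coefZ coefXn.
      have -> : (m == m - i)%N = false; last by rewrite mulr0.
      by apply/negP => /eqP; have := ltn_ord i; rewrite /m; lia.
    have nj' : (n < j)%N by rewrite ltn_neqAle eq_sym jn.
    rewrite [p`_j]nth_default ?mulr0 ?sub0r; last first.
      exact: leq_trans (leqSpred _) nj'.
    rewrite big1 ?mulr0 ?oppr0 // => i _; rewrite coefZ coefXn.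
    have -> : (j - (n - m) == m - i)%N = false; last by rewrite mulr0.
    by apply/negP => /eqP; lia.
  - have -> : 1 = 1 *: 1 - (0 *: 'X^(n - m)) * 'X^m :> {poly K}.
      by rewrite scale1r scale0r mul0r subr0.
    apply: residue_polyB.
      rewrite -!mul_polyC; apply: residue_polyM => //; apply: residue_polyC.
      by have := hp' 0%N; rewrite coef1.
    apply: residue_polyM => //; rewrite -!mul_polyC; apply: residue_polyM.
      apply: residue_polyC; have := hp n; rewrite coef1.
      by rewrite /n; case: (size p) p1 => [|[]].
    exact: residue_polyXn.
  - by rewrite hornerD hornerN hornerM revx mulr0 subr0 hornerZ px mulr0.
rewrite leqn0 addn_eq0 size_poly_eq0 => /andP[/eqP -> _].
by move/(_ 0%N); rewrite coef0 coef1 => /Gfun /eqP; rewrite (negPf (oner_neq0 _)).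
Qed.

Lemma maximal_place : place G.
Proof.
split=> // x x0.
have [|/not_residue_relation[p [hp px]]] := pselect (exists c, G (x, c)).
  by left.
have [[c Gc]|/not_residue_relation[p' [hp' p'x]]] :=
  pselect (exists c, G (x^-1, c)); last first.
  by case: (no_two_relations (divff x0) (leqnn _) hp px hp' p'x).
have [c0|c0] := eqVneq c 0; first by right; rewrite -c0.
by left; exists c^-1; rewrite -[x]invrK; apply: residue_inv.
Qed.

End Maximal.

(** Chevalley's extension theorem: a specialization of a subring of [L] to an
    algebraically closed field extends to a place, namely to any maximal partial
    place above it.  The section [sec] makes residues cover all of [K], which the
    ideal argument of [not_residue_relation] uses. *)
Lemma place_extension (T : nzRingType) (pi : {rmorphism T -> L})
    (ev : {rmorphism T -> K}) (sec : {rmorphism K -> T}) :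
  cancel sec ev -> (forall t, pi t = 0 -> ev t = 0) ->
  exists G, place G /\ forall t, G (pi t, ev t).
Proof.
move=> evK kerP.
pose G0 := [set z : L * K | exists t, z = (pi t, ev t)].
have G0p : partial_place G0.
  split.
  - by exists 1; rewrite !rmorph1.
  - by move=> _ _ _ _ [t [-> ->]] [t' [-> ->]]; exists (t - t'); rewrite !rmorphB.
  - by move=> _ _ _ _ [t [-> ->]] [t' [-> ->]]; exists (t * t'); rewrite !rmorphM.
  - by move=> c [t [/esym /kerP e ->]].
have [|G [Gp G0G Gmax]] := Zorn_above G0p.
  move=> C [Z CZ] Cp Ctot; split; first by exists Z => //; case: (Cp _ CZ).
  - move=> x y c d [X CX Xx] [Y CY Yy].
    have [XY|YX] := Ctot _ _ CX CY; [exists Y | exists X] => //.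
      by have [_ D _ _] := Cp _ CY; apply: D => //; apply: XY.
    by have [_ D _ _] := Cp _ CX; apply: D => //; apply: YX.
  - move=> x y c d [X CX Xx] [Y CY Yy].
    have [XY|YX] := Ctot _ _ CX CY; [exists Y | exists X] => //.
      by have [_ _ M _] := Cp _ CY; apply: M => //; apply: XY.
    by have [_ _ M _] := Cp _ CX; apply: M => //; apply: YX.
  - by move=> c [X CX Xc]; have [_ _ _] := Cp _ CX; apply.
exists G; split; last by move=> t; apply: G0G; exists t.
apply: (@maximal_place G (pi \o sec)) => //.
by move=> c; apply: G0G; exists (sec c); rewrite evK.
Qed.

Section PlaceTheory.
Variable G : set (L * K).
Hypothesis Gp : place G.

Lemma place_fun x c d : G (x, c) -> G (x, d) -> c = d.
Proof.
case: Gp => -[_ GB _ Gfun] _ Gc Gd; apply/eqP; rewrite -subr_eq0; apply/eqP.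
by apply: Gfun; rewrite -(subrr x); apply: GB.
Qed.

Lemma place_sum (I : Type) (s : seq I) (P : pred I) (u : I -> L) (v : I -> K) :
  (forall i, P i -> G (u i, v i)) ->
  G (\sum_(i <- s | P i) u i, \sum_(i <- s | P i) v i).
Proof.
case: Gp => -[G1 GB _ _] _ Guv.
have G0 : G (0, 0) by have := GB _ _ _ _ G1 G1; rewrite !subrr.
apply: (big_ind2 (fun a b => G (a, b))) => // x1 x2 y1 y2 G12 Gy.
by have := GB _ _ _ _ G12 (GB _ _ _ _ G0 Gy); rewrite !sub0r !opprK.
Qed.

End PlaceTheory.

End Places.

(** * Weights and torus points from ordered monomials *)

Section IntegerForms.
Variable n : nat.
Implicit Types (a b : 'rV[int]_n).

(** The inductions on the number of variables keep the ambient dimension fixed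
    and let the support grow instead. *)
Definition supported_below (k : nat) a := forall i : 'I_n, (k <= i)%N -> a 0 i = 0.

Lemma supported_belowD k a b :
  supported_below k a -> supported_below k b -> supported_below k (a + b).
Proof. by move=> ha hb i hi; rewrite mxE ha // hb // addr0. Qed.

Lemma supported_belowZ k (c : int) a :
  supported_below k a -> supported_below k (c *: a).
Proof. by move=> ha i hi; rewrite mxE ha // mulr0. Qed.

Lemma supported_belowS (k : nat) (hk : (k < n)%N) a :
  supported_below k.+1 a -> a 0 (Ordinal hk) = 0 -> supported_below k a.
Proof.
move=> ha a0 i; rewrite leq_eqVlt => /orP[/eqP ki|]; last exact: ha.
by rewrite -a0; congr (a 0 _); apply: val_inj.
Qed.

Lemma supported_below0 a : supported_below 0 a -> a = 0.
Proof. by move=> ha; apply/rowP => i; rewrite ha // mxE. Qed.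

Definition pairing (R : nzRingType) (w : 'I_n -> R) a := \sum_i w i * (a 0 i)%:~R.

Lemma pairingD (R : nzRingType) (w : 'I_n -> R) a b :
  pairing w (a + b) = pairing w a + pairing w b.
Proof.
by rewrite -big_split /=; apply: eq_bigr => i _; rewrite mxE intrD mulrDr.
Qed.

Lemma pairingZ (R : comNzRingType) (w : 'I_n -> R) (c : int) a :
  pairing w (c *: a) = c%:~R * pairing w a.
Proof.
by rewrite mulr_sumr; apply: eq_bigr => i _; rewrite mxE intrM mulrCA.
Qed.

Lemma pairingN (R : comNzRingType) (w : 'I_n -> R) a :
  pairing w (- a) = - pairing w a.
Proof. by rewrite -scaleN1r pairingZ mulN1r. Qed.

Section FourierMotzkin.
Variable P : 'rV[int]_n -> Prop.
Hypothesis PD : forall a b, P a -> P b -> P (a + b).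
Hypothesis Ptotal : forall a, P a \/ P (- a).

Let P0 : P 0.
Proof. by have [] := Ptotal 0; rewrite ?oppr0. Qed.

Let PZ (c : int) a : 0 <= c -> P a -> P (c *: a).
Proof.
case: c => // c _ Pa; elim: c => [|c IH]; first by rewrite scale0r.
by rewrite intS scalerDl scale1r; apply: PD.
Qed.

Let strict_pos a : ~ P (- a) -> P a.
Proof. by case: (Ptotal a). Qed.

Let strict_comb (c d : int) a b : 0 < c -> 0 <= d ->
  ~ P (- a) -> P b -> ~ P (- (c *: a + d *: b)).
Proof.
move=> c0 d0 na Pb Pab; apply: (na).
have -> : - a = - (c *: a + d *: b) + (d *: b + (c - 1) *: a).
  by rewrite scalerBl scale1r opprD -addrA !addKr.
apply: (PD) => //; apply: PD; apply: PZ => //; last exact: strict_pos.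
by rewrite subr_ge0 -gtz0_ge1.
Qed.

(** [P] is an abstract preorder on exponents: [P a] is to be read as finiteness
    of the monomial of exponent [a], and [~ P (- a)] as its being infinitely
    small. *)
Definition compatible (w : 'I_n -> rat) a :=
  (P a -> 0 <= pairing w a) /\ (~ P (- a) -> 0 < pairing w a).

(** The midpoint of the largest lower bound and the smallest upper bound; it
    attains a bound only when these two coincide. *)
Lemma separating_point (T : eqType) (A B : seq T) (l u : T -> rat) :
  (forall s t, s \in A -> t \in B -> l s <= u t) ->
  exists x,
    (forall s, s \in A -> l s < x \/ l s = x /\ exists2 t, t \in B & l s = u t) /\
    (forall t, t \in B -> x < u t \/ x = u t /\ exists2 s, s \in A & l s = u t).
Proof.
have maxP (s : seq T) (f : T -> rat) : s != [::] ->
    exists2 m, m \in s & forall t, t \in s -> f t <= f m.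
  elim: s => // a s IH _; case: (eqVneq s [::]) => [->|/IH[m ms hm]].
    by exists a; rewrite ?inE // => b; rewrite inE => /eqP ->.
  case: (leP (f m) (f a)) => fma.
    exists a; first by rewrite inE eqxx.
    by move=> b; rewrite inE => /orP[/eqP -> //|/hm /le_trans]; apply.
  exists m; first by rewrite inE ms orbT.
  by move=> b; rewrite inE => /orP[/eqP ->|/hm //]; apply: ltW.
move=> lu.
case: (eqVneq A [::]) => [->|/(maxP _ l)[a0 a0A amax]].
  case: (eqVneq B [::]) => [->|/(maxP _ (fun t => - u t))[b0 b0B bmin]].
    by exists 0.
  exists (u b0 - 1); split => // b bB; left; have := bmin b bB; lra.
case: (eqVneq B [::]) => [->|/(maxP _ (fun t => - u t))[b0 b0B bmin]].
  exists (l a0 + 1); split => // a aA; left; have := amax a aA; lra.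
exists ((l a0 + u b0) / 2%:R); have lu0 := lu _ _ a0A b0B.
split=> [a aA|b bB].
  have := amax a aA; case: (ltgtP (l a) ((l a0 + u b0) / 2%:R)) => h h'.
  - by left.
  - by exfalso; lra.
  - by right; split => //; exists b0 => //; lra.
have := bmin b bB; case: (ltgtP ((l a0 + u b0) / 2%:R) (u b)) => h h'.
- by left.
- by exfalso; lra.
- by right; split => //; exists a0 => //; lra.
Qed.

(** Fourier-Motzkin elimination of the last variable.  Positive combinations of
    a vector with positive and one with negative last entry lose that entry;
    a weight compatible with them leaves a consistent system of bounds for the
    last coordinate of the weight. *)
Lemma compatible_weight_below k (E : seq 'rV[int]_n) : (k <= n)%N ->
  (forall a, a \in E -> supported_below k a) ->
  exists w, forall a, a \in E -> compatible w a.
Proof.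
elim: k E => [|k IH] E hk hE.
  exists (fun=> 0) => a /hE /supported_below0 ->; split.
    by move=> _; rewrite /pairing big1 // => i _; rewrite mul0r.
  by rewrite oppr0.
pose i0 := Ordinal hk.
pose E0 := [seq a : 'rV[int]_n <- E | a 0 i0 == 0].
pose A := [seq a : 'rV[int]_n <- E | (0 < a 0 i0) && `[< P a >]].
pose B := [seq a : 'rV[int]_n <- E | (a 0 i0 < 0) && `[< P a >]].
(* The combination that cancels the entry [i0]. *)
pose comb a b := (- b 0 i0) *: a + (a 0 i0) *: b : 'rV[int]_n.
have [|w hw] := IH (E0 ++ [seq comb a b | a <- A, b <- B]) (ltnW hk).
  move=> c; rewrite mem_cat => /orP[|/allpairsP[[a b] /= [aA bB ->]]].
    by rewrite mem_filter => /andP[/eqP c0 /hE hc]; apply: supported_belowS c0.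
  have hi0 : comb a b 0 i0 = 0 by rewrite !mxE; ring.
  apply: supported_belowS hi0.
  move: aA bB; rewrite !mem_filter => /andP[_ /hE ha] /andP[_ /hE hb].
  by apply: supported_belowD; apply: supported_belowZ.
pose l a := - pairing w a / (a 0 i0)%:~R.
have lu a b : a \in A -> b \in B ->
    [/\ l a <= l b, ~ P (- a) -> l a < l b & ~ P (- b) -> l a < l b].
  move=> aA bB.
  have cE : comb a b \in E0 ++ [seq comb a b | a <- A, b <- B].
    by rewrite mem_cat; apply/orP; right; apply/allpairsP; exists (a, b).
  move: aA bB; rewrite !mem_filter.
  move=> /andP[/andP[a0 /asboolP Pa] _] /andP[/andP[b0 /asboolP Pb] _].
  have b0' : 0 < - b 0 i0 by rewrite oppr_gt0.
  have [h1 h2] := hw _ cE; move: h1 h2.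
  rewrite pairingD !pairingZ /l.
  have ra0 : 0 < (a 0 i0)%:~R :> rat by rewrite ltr0z.
  have rb0 : (b 0 i0)%:~R < 0 :> rat by rewrite ltrz0.
  move: ra0 rb0; rewrite rmorphN /=.
  set x := (a 0 i0)%:~R; set y := (b 0 i0)%:~R; set p := pairing w a; set q := pairing w b.
  move=> x0 y0 h1 h2.
  have le_lb : (- p / x <= - q / y) = (0 <= - y * p + x * q).
    rewrite ler_pdivrMr // mulrAC -[X in X <= _]mulrN1 -[_ / y]mulrNN -invrN.
    by rewrite ler_pdivlMr ?oppr_gt0 // -subr_ge0; congr (0 <= _); ring.
  have lt_lb : (- p / x < - q / y) = (0 < - y * p + x * q).
    rewrite ltr_pdivrMr // mulrAC -[X in X < _]mulrN1 -[_ / y]mulrNN -invrN.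
    by rewrite ltr_pdivlMr ?oppr_gt0 // -subr_gt0; congr (0 < _); ring.
  rewrite le_lb lt_lb; split.
  - by apply: h1; apply: PD; apply: PZ => //; apply: ltW.
  - by move=> na; apply: h2; apply: strict_comb => //; apply: ltW.
  - move=> nb; apply: h2; rewrite /comb addrC; apply: strict_comb => //.
    exact: ltW.
have [|x [xA xB]] := @separating_point _ A B l l.
  by move=> a b aA bB; have [] := lu a b aA bB.
exists (fun i => w i + (if i == i0 then x else 0)) => a aE.
have pE : pairing (fun i => w i + (if i == i0 then x else 0)) a =
    pairing w a + x * (a 0 i0)%:~R.
  rewrite /pairing; under eq_bigr do rewrite mulrDl.
  rewrite big_split /=; congr (_ + _).
  by rewrite (bigD1 i0) //= eqxx big1 ?addr0 // => i /negPf ->; rewrite mul0r.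
rewrite /compatible pE.
have [a0|a0|a0] := ltgtP (a 0 i0) 0.
- have ra0 : (a 0 i0)%:~R < 0 :> rat by rewrite ltrz0.
  have lt_x : (x < l a) -> 0 < pairing w a + x * (a 0 i0)%:~R.
    rewrite /l -[_ / _]mulrNN opprK -invrN ltr_pdivlMr ?oppr_gt0 //; lra.
  have eq_x : (x = l a) -> pairing w a + x * (a 0 i0)%:~R = 0.
    by move=> ->; rewrite /l divfK ?subrr ?lt_eqF.
  have aB : P a -> a \in B.
    by move=> Pa; rewrite mem_filter aE a0 andbT; apply/asboolP.
  split=> [Pa|na].
    have [/lt_x/ltW //|[/eq_x -> _ //]] := xB _ (aB Pa).
  have Pa := strict_pos na.
  have [/lt_x //|[_ [b bA lb]]] := xB _ (aB Pa).
  by have [_ _ /(_ na)] := lu _ _ bA (aB Pa); rewrite lb ltxx.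
- have ra0 : 0 < (a 0 i0)%:~R :> rat by rewrite ltr0z.
  have lt_x : (l a < x) -> 0 < pairing w a + x * (a 0 i0)%:~R.
    rewrite /l ltr_pdivrMr //; lra.
  have eq_x : (l a = x) -> pairing w a + x * (a 0 i0)%:~R = 0.
    by move=> <-; rewrite /l divfK ?subrr ?gt_eqF.
  have aA : P a -> a \in A.
    by move=> Pa; rewrite mem_filter aE a0 andbT; apply/asboolP.
  split=> [Pa|na].
    have [/lt_x/ltW //|[/eq_x -> _ //]] := xA _ (aA Pa).
  have Pa := strict_pos na.
  have [/lt_x //|[_ [b bB lb]]] := xA _ (aA Pa).
  by have [_ /(_ na) + _] := lu _ _ (aA Pa) bB; rewrite lb ltxx.
- rewrite a0 mulr0 addr0; apply: hw.
  by rewrite mem_cat mem_filter a0 eqxx aE.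
Qed.

Lemma compatible_weight (E : seq 'rV[int]_n) :
  exists w : 'I_n -> int, forall a, a \in E ->
    (P a -> 0 <= pairing w a) /\ (~ P (- a) -> 0 < pairing w a).
Proof.
have [w hw] : exists w, forall a, a \in E -> compatible w a.
  by apply: (@compatible_weight_below n) => // a _ i; rewrite leqNgt ltn_ord.
(* Clearing denominators does not change signs. *)
pose D : int := \prod_i denq (w i).
have D0 : 0 < D by apply: prodr_gt0 => i _; apply: denq_gt0.
have wD i : exists z : int, w i * D%:~R = z%:~R.
  exists (numq (w i) * \prod_(j | j != i) denq (w j)).
  rewrite /D (bigD1 i) //= !intrM mulrA; congr (_ * _).
  by rewrite -{1}[w i]divq_num_den divfK ?intr_eq0 ?denq_neq0.
have [z zE] := choice wD.
exists z => a /hw[h1 h2].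
have e : (pairing z a)%:~R = pairing w a * D%:~R :> rat.
  rewrite rmorph_sum /= mulr_suml; apply: eq_bigr => i _.
  by rewrite intrM intz -zE mulrAC.
have rD0 : 0 < D%:~R :> rat by rewrite ltr0z.
split=> [/h1|/h2] h; first by rewrite -(ler0z rat) e mulr_ge0 // ltW.
by rewrite -(ltr0z rat) e mulr_gt0.
Qed.

End FourierMotzkin.

Section Monomials.
Variable F : fieldType.
Implicit Types x y : 'I_n -> F.

Definition monomial x a : F := \prod_i x i ^ (a 0 i).

Lemma monomial_neq0 x a : (forall i, x i != 0) -> monomial x a != 0.
Proof. by move=> x0; apply/prodf_neq0 => i _; apply: expfz_neq0. Qed.

Lemma monomialD x a b : (forall i, x i != 0) ->
  monomial x (a + b) = monomial x a * monomial x b.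
Proof.
move=> x0; rewrite -big_split /=; apply: eq_bigr => i _.
by rewrite mxE expfzDr.
Qed.

Lemma monomial0 x : monomial x 0 = 1.
Proof. by rewrite /monomial big1 // => i _; rewrite mxE expr0z. Qed.

Lemma monomialN x a : (forall i, x i != 0) -> monomial x (- a) = (monomial x a)^-1.
Proof.
move=> x0; apply: (mulfI (monomial_neq0 a x0)).
by rewrite -monomialD // subrr monomial0 divff ?monomial_neq0.
Qed.

Lemma monomialM x y a : monomial (fun i => x i * y i) a = monomial x a * monomial y a.
Proof. by rewrite -big_split /=; apply: eq_bigr => i _; rewrite expfzMl. Qed.

End Monomials.

Section Characters.
Variables (K : closedFieldType) (H : 'rV[int]_n -> Prop) (eta : 'rV[int]_n -> K).
Hypotheses (H0 : H 0) (HB : forall a b, H a -> H b -> H (a - b)).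
Hypotheses (eta_neq0 : forall a, H a -> eta a != 0)
  (etaD : forall a b, H a -> H b -> eta (a + b) = eta a * eta b).

Lemma closed_rootX (d : nat) (c : K) : (0 < d)%N -> exists z, z ^+ d = c.
Proof.
move=> d0; have /closed_rootP[z] : size ('X^d - c%:P) != 1%N.
  by rewrite size_XnsubC // eqSS -lt0n.
by rewrite /root !hornerE subr_eq0 => /eqP zc; exists z.
Qed.

Lemma subgroup_scale (Q : 'rV[int]_n -> Prop) : Q 0 ->
  (forall a b, Q a -> Q b -> Q (a - b)) -> forall (c : int) a, Q a -> Q (c *: a).
Proof.
move=> Q0 QB; have QN a : Q a -> Q (- a) by rewrite -sub0r; apply: QB.
have Qn (c : nat) a : Q a -> Q (c%:Z *: a).
  move=> Qa; elim: c => [|c IH]; first by rewrite scale0r.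
  by rewrite intS scalerDl scale1r addrC -[a in _ + a]opprK; apply: QB => //; apply: QN.
case=> c a Qa; first exact: Qn.
by rewrite NegzE scaleNr; apply: QN; apply: Qn.
Qed.

(** The multiplicative group of [K] is divisible, so characters extend from
    subgroups.  One coordinate is added at a time: the last entries of [H] are
    the multiples of some [d], and only a [d]-th root has to be chosen. *)
Lemma character_extension_below k : (k <= n)%N ->
  exists x : 'I_n -> K, (forall i, x i != 0) /\
    forall a, H a -> supported_below k a -> monomial x a = eta a.
Proof.
elim: k => [_|k IH hk].
  exists (fun=> 1); split=> [i|a Ha /supported_below0 a0]; first exact: oner_neq0.
  rewrite a0 monomial0; apply: (mulfI (eta_neq0 H0)).
  by rewrite -etaD // addr0 mulr1.
have [x [x0 xP]] := IH (ltnW hk); pose i0 := Ordinal hk.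
have HN a : H a -> H (- a) by rewrite -sub0r; apply: HB.
pose good d := `[< (0 < d)%N /\ exists a, [/\ H a, supported_below k.+1 a &
  a 0 i0 = d%:Z] >].
have [[d0 gd0]|nd] := pselect (exists d, good d); last first.
  exists x; split => // a Ha sa; apply: xP => //; apply: (supported_belowS sa).
  apply: contrapT => /eqP ai0; apply: nd; exists (absz (a 0 i0)).
  apply/asboolP; split; first by rewrite absz_gt0.
  have [ap|an] := leP 0 (a 0 i0).
    by exists a; split => //; rewrite gez0_abs.
  exists (- a); split; [exact: HN | | by rewrite mxE ltz0_abs].
  by rewrite -scaleN1r; apply: supported_belowZ.
case: (ex_minnP (ex_intro _ d0 gd0)) => d /asboolP[d_gt0 [a1 [Ha1 sa1 a1d]]] dmin.
have [z zd] := closed_rootX (eta a1 / monomial x a1) d_gt0.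
have z0 : z != 0.
  apply: contraTneq (_ : eta a1 / monomial x a1 != 0) => [z0|].
    by rewrite -zd z0 expr0n gtn_eqF // eqxx.
  by rewrite mulf_neq0 ?invr_eq0 ?eta_neq0 ?monomial_neq0.
pose u i := if i == i0 then z else 1.
have u0 i : u i != 0 by rewrite /u; case: ifP => _; [exact: z0 | exact: oner_neq0].
have uE a : monomial u a = z ^ (a 0 i0).
  rewrite /monomial (bigD1 i0) //= /u eqxx big1 ?mulr1 // => i /negPf ->.
  exact: exp1rz.
pose x' i := x i * u i.
have x'0 i : x' i != 0 by rewrite mulf_neq0.
exists x'; split => //.
(* The exponents where the new point is already right form a group. *)
pose Q a := H a /\ monomial x' a = eta a.
have Q0 : Q 0.
  split=> //; rewrite monomial0; apply: (mulfI (eta_neq0 H0)).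
  by rewrite -etaD // addr0 mulr1.
have QB a b : Q a -> Q b -> Q (a - b).
  move=> [Ha ea] [Hb eb]; split; first exact: HB.
  apply: (mulIf (eta_neq0 Hb)); rewrite -etaD //; last exact: HB.
  by rewrite subrK -eb -monomialD // subrK.
have Q1 : Q a1.
  split=> //; rewrite monomialM uE a1d -[z ^ _]/(z ^+ d) zd.
  by rewrite mulrCA divff ?mulr1 ?monomial_neq0.
move=> a Ha sa.
pose q := divz (a 0 i0) d; pose b := a - q *: a1.
have Qq : Q (q *: a1) by apply: subgroup_scale.
have Hb : H b by apply: HB => //; case: Qq.
have sb : supported_below k.+1 b.
  by apply: supported_belowD => //; rewrite -scaleNr; apply: supported_belowZ.
have bi0 : b 0 i0 = modz (a 0 i0) d by rewrite !mxE a1d /modz.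
have Qb : Q b.
  split => //; rewrite monomialM uE.
  have bi00 : b 0 i0 = 0.
    apply: contrapT => /eqP nb0.
    have dn0 : d%:Z != 0 by rewrite eqz_nat -lt0n.
    have : (d <= absz (b 0 i0)%R)%N.
      apply: dmin; apply/asboolP; split; first by rewrite absz_gt0.
      by exists b; split => //; rewrite gez0_abs // bi0 modz_ge0.
    rewrite leqNgt -ltz_nat gez0_abs bi0 ?modz_ge0 //.
    by rewrite -[X in (_ < X)%R](gez0_abs (isT : 0 <= d%:Z)) ltz_mod.
  by rewrite bi00 expr0z mulr1; apply: xP => //; apply: supported_belowS bi00.
have [_ ->] : Q a; last by [].
rewrite -[a](subrK (q *: a1)) -/b -[q *: a1]opprK; apply: (QB) => //.
by rewrite -sub0r; apply: QB.
Qed.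

Lemma character_extension :
  exists x : 'I_n -> K, (forall i, x i != 0) /\ forall a, H a -> monomial x a = eta a.
Proof.
have [x [x0 xP]] := character_extension_below (leqnn n).
by exists x; split => // a Ha; apply: xP => // i; rewrite leqNgt ltn_ord.
Qed.

End Characters.

(** On finitely many monomials a place cannot be told apart from the place of a
    one-parameter arc [s |-> x_i s ^ w_i]. *)
Lemma toric_specialization (L : fieldType) (K : closedFieldType)
    (G : set (L * K)) (y : 'I_n -> L) (E : seq 'rV[int]_n) :
  place G -> (forall i, y i != 0) ->
  exists (w : 'I_n -> int) (x : 'I_n -> K), (forall i, x i != 0) /\
    forall a, a \in E ->
      [/\ G (monomial y a, 0) -> 0 < pairing w a,
          0 < pairing w a -> G (monomial y a, 0) &
          pairing w a = 0 -> G (monomial y a, monomial x a)].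
Proof.
move=> Gp y0; have [[G1 GB GM Gfun] Gtot] := Gp.
pose P a := exists c, G (monomial y a, c).
have PD a b : P a -> P b -> P (a + b).
  by move=> [c Gc] [d Gd]; exists (c * d); rewrite monomialD //; apply: GM.
have tot a : P a \/ G (monomial y (- a), 0).
  by rewrite monomialN //; apply: Gtot; apply: monomial_neq0.
have Ptotal a : P a \/ P (- a).
  by have [|g] := tot a; [left | right; exists 0].
pose H a := P a /\ P (- a).
have /choice[eta etaP] a : exists c, H a -> G (monomial y a, c).
  have [[[c Gc] _]|nH] := pselect (H a); first by exists c.
  by exists 0.
(* [H] is the group of exponents of units, and [eta] their residues. *)
have H0 : H 0 by rewrite /H oppr0; split; exists 1; rewrite monomial0.
have HB a b : H a -> H b -> H (a - b).
  by move=> [Pa Pa'] [Pb Pb']; split; rewrite ?opprB ?[b - a]addrC; apply: PD.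
have HN a : H a -> H (- a) by rewrite -sub0r; apply: HB.
have HD a b : H a -> H b -> H (a + b).
  by move=> Ha Hb; rewrite -[b]opprK; apply: HB => //; apply: HN.
have etaD a b : H a -> H b -> eta (a + b) = eta a * eta b.
  move=> Ha Hb; apply: (place_fun Gp) (etaP _ (HD _ _ Ha Hb)) _.
  by rewrite monomialD //; apply: GM; apply: etaP.
have eta0 : eta 0 = 1 by apply: (place_fun Gp) (etaP _ H0) _; rewrite monomial0.
have eta_neq0 a : H a -> eta a != 0.
  move=> Ha; apply: contraNneq (oner_neq0 K) => e0.
  by rewrite -eta0 -(subrr a) etaD ?e0 ?mul0r //; apply: HN.
have [x [x0 xP]] := character_extension H0 HB eta_neq0 etaD.
have [w wP] := compatible_weight PD Ptotal (E ++ [seq - a | a <- E]).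
exists w, x; split => // a aE.
have [w1 w2] : (P a -> 0 <= pairing w a) /\ (~ P (- a) -> 0 < pairing w a).
  by apply: wP; rewrite mem_cat aE.
have [w3 w4] : (P (- a) -> pairing w a <= 0) /\ (~ P a -> pairing w a < 0).
  have [|h1 h2] := wP (- a); first by rewrite mem_cat map_f ?orbT.
  by move: h1 h2; rewrite pairingN opprK oppr_ge0 oppr_gt0.
split.
- move=> g0; apply: w2 => -[c Gc].
  have /eqP : 0 * c = 1 :> K.
    apply: (place_fun Gp (GM _ _ _ _ g0 Gc)).
    by rewrite -monomialD // subrr monomial0.
  by rewrite mul0r eq_sym (negPf (oner_neq0 K)).
- move=> wa; have [|] := tot (- a); last by rewrite opprK.
  by move=> /w3; rewrite leNgt wa.
- move=> wa; rewrite xP; first apply: etaP.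
  all: by split; apply: contrapT; [move/w4 | move/w2]; rewrite wa ltxx.
Qed.

End IntegerForms.

(** * Newton diagrams and coordinate subspaces *)

Section Digits.
Local Open Scope nat_scope.

Lemma digit_sum_lt D N (a : 'I_N -> nat) : (forall i, a i < D) ->
  \sum_(i < N) a i * D ^ i < D ^ N.
Proof.
elim: N a => [|N IH] a ha; first by rewrite big_ord0.
rewrite big_ord_recr /= expnS.
have := IH (fun i => a (widen_ord (leqnSn N) i)) (fun i => ha _).
have := ha ord_max; rewrite -(leq_pmul2r (m := D ^ N)); last first.
  by rewrite expn_gt0 (leq_ltn_trans _ (ha ord_max)).
move=> h1 h2; apply: leq_trans h1.
by rewrite mulSn ltn_add2r.
Qed.

Lemma digit_sum_inj D N (a b : 'I_N -> nat) :
  (forall i, a i < D) -> (forall i, b i < D) ->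
  \sum_(i < N) a i * D ^ i = \sum_(i < N) b i * D ^ i -> a =1 b.
Proof.
elim: N a b => [|N IH] a b ha hb; first by move=> _ [].
rewrite !big_ord_recr /=.
have := digit_sum_lt (fun i => ha (widen_ord (leqnSn N) i)).
have := digit_sum_lt (fun i => hb (widen_ord (leqnSn N) i)).
set u := (\sum_(i < N) a _ * _); set v := (\sum_(i < N) b _ * _) => hv hu e.
have DN : 0 < D ^ N by apply: leq_ltn_trans hv.
have quo w c : w < D ^ N -> (w + c * D ^ N) %/ D ^ N = c.
  by move=> hw; rewrite divnDMl // divn_small.
have em : a ord_max = b ord_max by rewrite -(quo _ (a ord_max) hu) e quo.
move: e; rewrite em => /eqP; rewrite eqn_add2r => /eqP e i.
case: (unliftP ord_max i) => [j|] -> //.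
have := IH _ _ (fun i => ha (widen_ord (leqnSn N) i))
  (fun i => hb (widen_ord (leqnSn N) i)) e j.
by congr (a _ = b _); apply: val_inj; exact: (esym (lift_max j)).
Qed.

End Digits.

Section NewtonDiagrams.
Local Open Scope classical_set_scope.
Variables (R : realType) (n : nat) (K : closedFieldType).
Implicit Types (c x y : 'rV[R]_n) (I : {set 'I_n}) (m : 'X_{1..n}).
Implicit Types (p : {mpoly K[n]}).

(** The exponents of the monomials that survive on the coordinate subspace of
    [I]. *)
Definition supported_in I m := [forall i, (i \notin I) ==> (m i == 0%N)].

Lemma supported_inP I m :
  reflect (forall i, i \notin I -> m i = 0%N) (supported_in I m).
Proof.
apply: (iffP forallP) => h i; first by move=> iI; apply/eqP/(implyP (h i)).
by apply/implyP => /h ->.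
Qed.

Lemma newton_polytope_sub p (C : set 'rV[R]_n) :
  (forall x y (l : R), C x -> C y -> 0 < l -> l < 1 -> C (l *: x + (1 - l) *: y)) ->
  (forall m, m \in msupp p -> C (exponent_vector R m)) ->
  newton_polytope p `<=` C.
Proof.
move=> Cconv Cp; apply: smallest_sub; last by move=> _ [m mp <-]; apply: Cp.
apply/convex_setW => x y; rewrite !inE => Cx Cy l l0 l1.
by rewrite inE; apply: Cconv.
Qed.

Lemma exponent_in_polyhedron p m : m \in msupp p ->
  newton_polyhedron p (exponent_vector R m).
Proof.
move=> mp; exists 0; first by move=> i; rewrite mxE.
exists (exponent_vector R m); last by rewrite add0r.
by apply: sub_gen_smallest; exists m.
Qed.

Section Vertex.
Variables (I : {set 'I_n}) (p : {mpoly K[n]}).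

Let D := msize p.
Let digit_place (i : 'I_n) : nat := if i \in I then i : nat else (n + i)%N.
Let weight m : nat := (\sum_i m i * D ^ digit_place i)%N.
Let digits m (k : 'I_(n + n)) : nat :=
  match fintype.split k with
  | inl i => if i \in I then m i else 0%N
  | inr i => if i \in I then 0%N else m i
  end.

Let weightE m : weight m = (\sum_k digits m k * D ^ k)%N.
Proof.
rewrite big_split_ord /= -big_split /=; apply: eq_bigr => i _.
rewrite /digits /digit_place (unsplitK (inl i)) (unsplitK (inr i)).
by case: (i \in I); rewrite mul0n ?addn0 ?add0n.
Qed.

Let exponent_lt m i : m \in msupp p -> (m i < D)%N.
Proof.
move=> /msize_mdeg_lt; apply: leq_ltn_trans.
by rewrite mdegE (bigD1 i) //= leq_addr.
Qed.

Let digits_lt m k : m \in msupp p -> (digits m k < D)%N.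
Proof.
move=> mp; have D0 : (0 < D)%N by apply: leq_ltn_trans (msize_mdeg_lt mp).
by rewrite /digits; case: fintype.split => i; case: ifP => // _; apply: exponent_lt.
Qed.

Let weight_inj m m' : m \in msupp p -> m' \in msupp p ->
  weight m = weight m' -> m = m'.
Proof.
move=> mp mp'; rewrite !weightE => /digit_sum_inj e.
apply/mnmP => i; have {}e := e (fun k => digits_lt k mp) (fun k => digits_lt k mp').
have := e (lshift n i); have := e (rshift n i).
by rewrite /digits (unsplitK (inl i)) (unsplitK (inr i)); case: (i \in I).
Qed.

Let weight_supported m : m \in msupp p ->
  (weight m < D ^ n)%N = supported_in I m.
Proof.
move=> mp; apply/idP/supported_inP => [mlt i iI|mI].
  apply/eqP; rewrite -leqn0 leqNgt; apply/negP => mi.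
  move: mlt; rewrite ltnNge => /negP; apply.
  rewrite /weight (bigD1 i) //= /digit_place (negPf iI).
  apply: leq_trans (leq_addr _ _); rewrite expnD mulnCA.
  apply: leq_pmulr; rewrite muln_gt0 mi expn_gt0.
  by rewrite (leq_ltn_trans _ (msize_mdeg_lt mp)).
apply: leq_ltn_trans (digit_sum_lt (fun i => exponent_lt i mp)).
apply: leq_sum => i _; rewrite /digit_place; case: ifPn => // /mI ->.
by rewrite mul0n.
Qed.

(** The functional with weights [D ^ digit_place i] reads exponents as digits in
    base [D], so it takes distinct values on the support and its face is a
    vertex.  Coordinates outside [I] get the high places, which puts the vertex
    in the subspace as soon as some exponent lies there. *)
Lemma diagram_meets_of_supp m1 : m1 \in msupp p -> supported_in I m1 ->
  newton_diagram p `&` (coordinate_subspace I : set 'rV[R]_n) !=set0.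
Proof.
move=> m1p m1I.
have [m0 m0p m0min] : exists2 m0, m0 \in msupp p &
    forall m, m \in msupp p -> (weight m0 <= weight m)%N.
  have ex : exists w, has (fun m => weight m == w) (msupp p).
    by exists (weight m1); apply/hasP; exists m1.
  case: (ex_minnP ex) => w /hasP[m0 m0p /eqP <-] wmin.
  by exists m0 => // m mp; apply: wmin; apply/hasP; exists m.
have m0I : supported_in I m0.
  rewrite -weight_supported //; apply: leq_ltn_trans (m0min _ m1p) _.
  by rewrite weight_supported.
exists (exponent_vector R m0); split; last first.
  by move=> i /(supported_inP _ _ m0I) mi; rewrite mxE mi.
pose c : 'rV[R]_n := \row_i (D ^ digit_place i)%:R.
pose v x := \sum_i c 0 i * x 0 i.
have vD x y : v (x + y) = v x + v y.
  by rewrite /v -big_split /=; apply: eq_bigr => i _; rewrite [(x + y) 0 i]mxE mulrDr.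
have vZ (l : R) x : v (l *: x) = l * v x.
  by rewrite /v mulr_sumr; apply: eq_bigr => i _; rewrite [(l *: x) 0 i]mxE mulrCA.
have vE m : v (exponent_vector R m) = (weight m)%:R.
  by rewrite /v /weight natr_sum; apply: eq_bigr => i _; rewrite !mxE mulrC natrM.
have D0 : (0 < D)%N by apply: leq_ltn_trans (msize_mdeg_lt m0p).
have c0 i : 0 < c 0 i by rewrite mxE ltr0n expn_gt0 D0.
pose e0 := exponent_vector R m0.
have polytope_min y : newton_polytope p y -> v e0 < v y \/ y = e0.
  move: y; apply: newton_polytope_sub => [x y l|m mp]; last first.
    have [->|nm] := eqVneq m m0; first by right.
    left; rewrite !vE ltr_nat ltn_neqAle m0min // andbT.
    by apply: contraNneq nm => /weight_inj ->.
  move=> hx hy l0 l1.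
  have l1' : 0 < 1 - l by rewrite subr_gt0.
  rewrite vD !vZ; case: hx hy => [hx|->] [hy|->].
  - by left; nra.
  - by left; nra.
  - by left; nra.
  - by right; rewrite -scalerDl addrC subrK scale1r.
have polyhedron_min x : newton_polyhedron p x -> v e0 <= v x /\ (v x <= v e0 -> x = e0).
  move=> [u u0 [y yp <-]]; rewrite vD.
  have vu i : 0 <= c 0 i * u 0 i by apply: mulr_ge0; [exact: ltW | exact: u0].
  have vu0 : 0 <= v u by apply: sumr_ge0.
  have vy : v e0 <= v y by have [/ltW //|->] := polytope_min _ yp.
  split; first by lra.
  move=> h; have /eqP vu00 : v u == 0 by rewrite eq_le vu0 andbT; lra.
  have -> : u = 0.
    apply/rowP => i; rewrite mxE; apply: (mulfI (lt0r_neq0 (c0 i))).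
    by rewrite mulr0; move/psumr_eq0P : vu00 => /(_ (fun i _ => vu i)); apply.
  have [|->] := polytope_min _ yp; last by rewrite add0r.
  by move: h; rewrite vu00 add0r leNgt => /negbTE ->.
exists [set e0]; split => //; last exact: compact_set1.
exists c; rewrite eqEsubset; split => x /=.
  move=> ->; split; first exact: exponent_in_polyhedron.
  by move=> y /polyhedron_min[].
move=> [xp]; move=> /(_ e0 (exponent_in_polyhedron m0p)).
by have [_] := polyhedron_min _ xp.
Qed.

End Vertex.

(** A point of the polyhedron in the subspace cannot come from exponents outside
    of it: for those the coordinates outside [I] add up to at least 1, and so
    they do on the convex hull. *)
Lemma newton_diagram_meets I p :
  (newton_diagram p `&` (coordinate_subspace I : set 'rV[R]_n) !=set0) <->
  has (supported_in I) (msupp p).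
Proof.
split=> [[x [[F [[c ->] _ [xp _]]] xI]]|/hasP[m]]; last exact: diagram_meets_of_supp.
apply/negPn/negP => /hasPn nI.
have {xp} [u u0 [y yp xE]] := xp.
pose s (z : 'rV[R]_n) : R := \sum_(i | i \notin I) z 0 i.
have [y0 y1] : (forall i, 0 <= y 0 i) /\ 1 <= s y.
  move: y yp {xE}; apply: newton_polytope_sub => [a b l [a0 a1] [b0 b1] l0 l1|m mp].
    have l1' : 0 < 1 - l by rewrite subr_gt0.
    split=> [i|]; first by rewrite !mxE addr_ge0 // mulr_ge0 // ltW.
    have -> : s (l *: a + (1 - l) *: b) = l * s a + (1 - l) * s b.
      by rewrite /s !mulr_sumr -big_split /=; apply: eq_bigr => i _; rewrite !mxE.
    by nra.
  split=> [i|]; first by rewrite mxE ler0n.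
  have := nI _ mp; rewrite negb_forall => /existsP[i]; rewrite negb_imply => /andP[iI mi].
  rewrite /s (bigD1 i) //= mxE -[leLHS]addr0; apply: lerD.
    by rewrite ler1n lt0n.
  by apply: sumr_ge0 => j _; rewrite mxE ler0n.
have : s y = 0.
  apply: big1 => i iI; have := xI i iI; rewrite -xE mxE => e.
  by apply/eqP; rewrite eq_le y0 andbT; have := u0 i; lra.
by lra.
Qed.

End NewtonDiagrams.

(** * Equations needed for a finite multiplicity *)

Section GeneratedIdeals.
Variable T : comNzRingType.
Implicit Types (S : seq T) (p : T).

Definition generated S p := exists q : nat -> T, p = \sum_(l < size S) q l * S`_l.

Lemma generated0 S : generated S 0.
Proof. by exists (fun=> 0); rewrite big1 // => l _; rewrite mul0r. Qed.

Lemma generatedD S p p' : generated S p -> generated S p' -> generated S (p + p').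
Proof.
move=> [q ->] [q' ->]; exists (fun l => q l + q' l).
by rewrite -big_split; apply: eq_bigr => l _; rewrite mulrDl.
Qed.

Lemma generatedM S a p : generated S p -> generated S (a * p).
Proof.
move=> [q ->]; exists (fun l => a * q l).
by rewrite mulr_sumr; apply: eq_bigr => l _; rewrite mulrA.
Qed.

Lemma generated_sum S (J : Type) (r : seq J) (P : pred J) (F : J -> T) :
  (forall j, P j -> generated S (F j)) -> generated S (\sum_(j <- r | P j) F j).
Proof.
move=> SF; apply: big_ind => //; first exact: generated0.
by move=> *; apply: generatedD.
Qed.

Lemma mem_generated S p : p \in S -> generated S p.
Proof.
move=> pS; exists (fun l => (l == index p S)%:R).
have hp : (index p S < size S)%N by rewrite index_mem.
rewrite (bigD1 (Ordinal hp)) //= eqxx mul1r nth_index // big1 ?addr0 // => l.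
by rewrite -val_eqE /= => /negPf ->; rewrite mul0r.
Qed.

End GeneratedIdeals.

Lemma generated_map (T T' : comNzRingType) (phi : {rmorphism T -> T'}) S p :
  generated S p -> generated (map phi S) (phi p).
Proof.
move=> [q ->]; exists (phi \o q); rewrite size_map rmorph_sum.
by apply: eq_bigr => l _; rewrite rmorphM (nth_map 0).
Qed.

Section FewEquations.
Variables (F : fieldType) (n : nat).

Lemma few_generators (S : seq {mpoly F[n]}) : (size S < n)%N ->
  (forall p, p \in S -> p@_0%MM = 0) ->
  exists i, forall s r, s@_0%MM != 0 ->
    ~ (forall N, exists2 p, generated S p & vanish N (s * 'X_i ^+ r - p)).
Proof.
move=> Sn S0.
have [|i iP] := @few_equations F n _ (fun l : 'I_(size S) => S`_l) Sn.
  by move=> l; apply: S0; apply: mem_nth.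
exists i => s r s0 H; apply: (iP s r s0) => N.
by have [p [q ->] v] := H N; exists (fun l => q l).
Qed.

Lemma generated_variables (I : {set 'I_n}) (S : seq {mpoly F[n]}) p :
  (forall i, i \notin I -> 'X_i \in S) -> ~~ has (supported_in I) (msupp p) ->
  generated S p.
Proof.
move=> SX /hasPn pI; rewrite [p]mpolyE big_seq; apply: generated_sum => m mp.
have := pI m mp; rewrite negb_forall => /existsP[i]; rewrite negb_imply => /andP[iI mi].
have -> : p@_m *: 'X_[m] = (p@_m *: 'X_[m - U_(i)]) * 'X_i.
  by rewrite -scalerAl -mpolyXD submK // lep1mP.
by apply: generatedM; apply: mem_generated; apply: SX.
Qed.

End FewEquations.

Section Multiplicity.
Local Open Scope classical_set_scope.
Variables (K : closedFieldType) (n : nat).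
Implicit Types (g : 'I_n -> {mpoly K[n]}).

Definition truncation N (a : pseries K n) : {mpoly K[n]} :=
  \sum_(m : 'X_{1..n < N}) (a m *: 'X_[m]).

Lemma psmul_truncation N a (p : {mpoly K[n]}) m : (mdeg m < N)%N ->
  psmul a (ps_of_mpoly p) m = (truncation N a * p)@_m.
Proof.
move=> mN; rewrite mcoeffM; apply: eq_bigr => k _; congr (_ * _).
rewrite mcoeff_mpoly //; apply: leq_ltn_trans mN.
by rewrite -ltnS bmdeg.
Qed.

Lemma ps_idealP g h :
  ps_ideal g h -> exists a : 'I_n -> pseries K n,
    forall m, h m = \sum_j psmul (a j) (ps_of_mpoly (g j)) m.
Proof. by move=> [a ->]; exists a => m; rewrite fct_sumE. Qed.

(** The [d + 1] first powers of a variable are dependent in a quotient of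
    dimension [d].  A dependence is a power of the variable times a polynomial
    with nonzero constant term, which is a unit of the power series ring. *)
Lemma power_of_finite_basis g d (e : 'I_d -> pseries K n) (i : 'I_n) :
  quotient_basis (ps_ideal g) e ->
  exists (s : {mpoly K[n]}) (r : nat), s@_0%MM != 0 /\
    forall N, exists q : 'I_n -> {mpoly K[n]},
      vanish N (s * 'X_i ^+ r - \sum_j q j * g j).
Proof.
move=> [gen _].
have [C CP] := choice (fun l : 'I_d.+1 => gen (ps_of_mpoly ('X_i ^+ l))).
have [a aP] := choice (fun l => ps_idealP (CP l)).
pose M := \matrix_(l < d.+1, k < d) C l k.
have : kermx M != 0.
  rewrite kermx_eq0 /row_free neq_ltn ltnS.
  by rewrite (leq_trans (rank_leq_col M)).
case/rowV0Pn => v /sub_kermxP vM v0.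
have [l1 vl1] : exists l, v 0 l != 0.
  by apply/existsP; rewrite -negb_forall; apply: contraNN v0 => /forallP h;
    apply/eqP/rowP => l; rewrite mxE; apply/eqP.
case: (@arg_minnP _ l1 (fun l => v 0 l != 0) (fun l : 'I_d.+1 => l : nat) vl1) => l0 vl0 l0min.
pose s : {mpoly K[n]} := \sum_(l < d.+1 | (l0 <= l)%N) v 0 l *: 'X_i ^+ (l - l0).
exists s, l0; split.
  rewrite raddf_sum (bigD1 l0) //= subnn expr0 mcoeffZ mcoeff1 eqxx mulr1.
  rewrite big1 ?addr0 // => l /andP[ll0 nl]; rewrite mcoeffZ mpolyXn mcoeffX.
  rewrite -mdeg_eq0 mdegMn mdeg1 mul1n subn_eq0.
  suff /negPf -> : ~~ (l <= l0)%N by rewrite mulr0.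
  by rewrite -ltnNge ltn_neqAle ll0 andbT eq_sym.
move=> N; exists (fun j => \sum_l v 0 l *: truncation N (a l j)) => m mN.
have -> : s * 'X_i ^+ l0 = \sum_l v 0 l *: 'X_i ^+ l.
  rewrite [RHS](bigID (fun l : 'I_d.+1 => l0 <= l)%N) /= [X in _ + X]big1 ?addr0.
    by rewrite mulr_suml; apply: eq_bigr => l ll0; rewrite -scalerAl -exprD subnK.
  move=> l ll0; suff /eqP -> : v 0 l == 0 by rewrite scale0r.
  by apply: contraNT ll0 => /l0min.
apply/eqP; rewrite mcoeffB subr_eq0; apply/eqP; rewrite !raddf_sum /=.
have hl (l : 'I_d.+1) : ('X_i ^+ l : {mpoly K[n]})@_m = \sum_k C l k * e k m +
    \sum_j (truncation N (a l j) * g j)@_m.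
  have hlm : ps_of_mpoly ('X_i ^+ l) m - (\sum_k C l k *: e k) m
      = \sum_j psmul (a l j) (ps_of_mpoly (g j)) m by rewrite -(aP l m).
  rewrite fct_sumE in hlm; move/eqP: hlm; rewrite subr_eq addrC => /eqP.
  rewrite [LHS]/ps_of_mpoly => ->.
  by congr (_ + _); apply: eq_bigr => j _; apply: psmul_truncation.
under eq_bigr do rewrite mcoeffZ hl mulrDr.
rewrite big_split /= [X in X + _](_ : _ = 0) ?add0r.
  under [RHS]eq_bigr do rewrite mulr_suml raddf_sum.
  rewrite exchange_big; apply: eq_bigr => l _ /=.
  by rewrite mulr_sumr; apply: eq_bigr => j _; rewrite -scalerAl mcoeffZ.
under eq_bigr do rewrite mulr_sumr.
rewrite exchange_big big1 // => k _.
transitivity ((v *m M) 0 k * e k m); last by rewrite vM mxE mul0r.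
by rewrite mxE mulr_suml; apply: eq_bigr => l _; rewrite mxE mulrA.
Qed.

(** Together with the variables outside [I], the [g j] that do not vanish on the
    subspace generate an ideal containing all the others, hence all [g j].  If
    they were fewer than [#|I|], there would be fewer than [n] generators, and
    the multiplicity would be infinite. *)
Lemma enough_equations g (I : {set 'I_n}) d (e : 'I_d -> pseries K n) :
  quotient_basis (ps_ideal g) e -> (forall j, (g j)@_0%MM = 0) ->
  (#|I| <= #|[set j | has (supported_in I) (msupp (g j))]%SET|)%N.
Proof.
move=> basis g0; rewrite leqNgt; apply/negP => few.
pose A := [set j | has (supported_in I) (msupp (g j))]%SET.
pose S := [seq g j | j in A] ++ [seq ('X_i : {mpoly K[n]}) | i in (~: I)%SET].
have Sn : (size S < n)%N.
  rewrite size_cat !size_map -!cardE -[ltnRHS](card_ord n) -(cardsC I).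
  by rewrite ltn_add2r.
have [|i iP] := few_generators Sn.
  move=> p; rewrite mem_cat => /orP[] /mapP[j _ ->] //.
  by rewrite mcoeffX mnm1_eq0.
have [s [r [s0 H]]] := power_of_finite_basis i basis.
apply: (iP s r s0) => N; have [q v] := H N.
exists (\sum_j q j * g j) => //.
apply: generated_sum => j _; apply: generatedM.
have [jA|jA] := boolP (j \in A).
  apply: mem_generated; rewrite mem_cat; apply/orP; left; apply/mapP.
  by exists j; rewrite // mem_enum.
apply: (@generated_variables _ _ I); last by rewrite inE in jA.
move=> i' iI; rewrite mem_cat; apply/orP; right; apply/mapP.
by exists i'; rewrite // mem_enum inE.
Qed.

Lemma finite_mult0 (R : realType) (D : 'I_n -> set 'rV[R]_n) :
  (mult0 K D < +oo)%E ->
  exists g, (forall j, newton_diagram (g j) = D j) /\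
    exists d (e : 'I_d -> pseries K n), quotient_basis (ps_ideal g) e.
Proof.
move=> /ereal_inf_lt[_ [g gD <-] /ereal_inf_lt[_ [d [e de] _] _]].
by exists g; split => //; exists d, e.
Qed.

End Multiplicity.

(** * Initial forms at a place *)

Section RestrictedInitialForms.
Variables (K : closedFieldType) (n : nat).
Implicit Types (p : {mpoly K[n]}) (m : 'X_{1..n}) (I : {set 'I_n}) (nu : 'I_n -> nat).

Lemma mcoeff_restriction I p m :
  (restriction I p)@_m = if supported_in I m then p@_m else 0.
Proof.
have XE m' : 'X_[m'] \mPo [tuple if i \in I then 'X_i else 0 | i < n] =
    if supported_in I m' then 'X_[m'] else 0 :> {mpoly K[n]}.
  rewrite comp_mpolyX; case: ifPn => [/supported_inP mI|].
    rewrite mpolyXE_id; apply: eq_bigr => i _; rewrite tnth_mktuple.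
    by case: ifPn => // /mI ->; rewrite !expr0.
  rewrite negb_forall => /existsP[i]; rewrite negb_imply => /andP[iI mi].
  by rewrite (bigD1 i) //= tnth_mktuple (negPf iI) expr0n (negPf mi) mul0r.
rewrite /restriction comp_mpolyEX raddf_sum /= [in RHS](mpolyE p) raddf_sum /=.
case: ifPn => mI.
  apply: eq_bigr => m' _; rewrite !mcoeffZ XE mcoeffX.
  case: ifPn => // m'I; first by rewrite mcoeffX.
  by rewrite mcoeff0; case: eqP => // mm; rewrite mm mI in m'I.
apply: big1 => m' _; rewrite mcoeffZ XE; case: ifPn => m'I; last by rewrite mcoeff0 mulr0.
by rewrite mcoeffX; case: eqP => [mm|_]; [rewrite -mm m'I in mI | rewrite mulr0].
Qed.

Lemma msupp_restriction I p :
  perm_eq (msupp (restriction I p)) [seq m <- msupp p | supported_in I m].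
Proof.
apply: uniq_perm; rewrite ?filter_uniq ?msupp_uniq // => m.
rewrite mem_filter !mcoeff_msupp mcoeff_restriction.
by case: ifP => //; rewrite eqxx.
Qed.

(** An initial form is determined by any lightest monomial, so its value is a
    sum over one level of the weight. *)
Lemma initial_form_restriction_eval I nu p (x : 'I_n -> K) m0 :
  m0 \in msupp p -> supported_in I m0 ->
  (forall m, m \in msupp p -> supported_in I m ->
     (mnm_weight I nu m0 <= mnm_weight I nu m)%N) ->
  (initial_form I nu (restriction I p)).@[x] =
  \sum_(m <- msupp p | supported_in I m && (mnm_weight I nu m == mnm_weight I nu m0))
     p@_m * \prod_i x i ^+ m i.
Proof.
move=> m0p m0I m0min; rewrite raddf_sum /=.
have memE := perm_mem (msupp_restriction I p).
have allE m : m \in msupp (restriction I p) ->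
    all (fun m' => mnm_weight I nu m <= mnm_weight I nu m')%N (msupp (restriction I p))
    = (mnm_weight I nu m == mnm_weight I nu m0).
  rewrite memE mem_filter => /andP[mI mp]; apply/allP/eqP => [h|-> m'].
    apply/eqP; rewrite eqn_leq m0min // andbT; apply: h.
    by rewrite memE mem_filter m0I.
  by rewrite memE mem_filter => /andP[m'I m'p]; apply: m0min.
transitivity (\sum_(m <- msupp (restriction I p) |
    mnm_weight I nu m == mnm_weight I nu m0) ((restriction I p)@_m *: 'X_[m]).@[x]).
  rewrite [LHS]big_seq_cond [RHS]big_seq_cond; apply: eq_bigl => m.
  by case: (boolP (m \in _)) => [/allE -> |].
rewrite (perm_big _ (msupp_restriction I p)) big_filter_cond /=.
apply: eq_bigr => m /andP[mI _]; rewrite mevalZ mevalX.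
by rewrite mcoeff_restriction mI.
Qed.

Lemma initial_form_restriction_eval0 I nu p (x : 'I_n -> K) :
  ~~ has (supported_in I) (msupp p) ->
  (initial_form I nu (restriction I p)).@[x] = 0.
Proof.
rewrite has_filter negbK => /eqP f0; rewrite /initial_form.
have := msupp_restriction I p; rewrite f0 => /perm_nilP ->.
by rewrite big_nil meval0.
Qed.

Lemma lightest_supported I nu p : has (supported_in I) (msupp p) ->
  exists m0, [/\ m0 \in msupp p, supported_in I m0 &
    forall m, m \in msupp p -> supported_in I m ->
     (mnm_weight I nu m0 <= mnm_weight I nu m)%N].
Proof.
move=> /hasP[m1 m1p m1I].
have ex : exists w, has (fun m => supported_in I m && (mnm_weight I nu m == w)) (msupp p).
  by exists (mnm_weight I nu m1); apply/hasP; exists m1; rewrite // m1I eqxx.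
case: (ex_minnP ex) => w /hasP[m0 m0p /andP[m0I /eqP <-]] wmin.
exists m0; split => // m mp mI.
by apply: wmin; apply/hasP; exists m; rewrite // mI eqxx.
Qed.

End RestrictedInitialForms.

Section DegenerateOfPlace.
Variables (L : fieldType) (K : closedFieldType) (n : nat).
Variables (G : set (L * K)) (sigma : {rmorphism K -> L}).
Hypotheses (Gp : place G) (Gsigma : forall c, G (sigma c, c)).
Variables (J : {set 'I_n}) (y : 'I_n -> L).
Hypotheses (y_neq0 : forall i, y i != 0) (yJ : forall i, i \in J -> G (y i, 0)).
Implicit Types (m : 'X_{1..n}).

Definition exponent m : 'rV[int]_n := \row_i (m i)%:Z.

Lemma monomial_exponent (F : fieldType) (x : 'I_n -> F) m :
  monomial x (exponent m) = \prod_i x i ^+ m i.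
Proof. by apply: eq_bigr => i _; rewrite mxE. Qed.

Lemma monomial_delta (F : fieldType) (x : 'I_n -> F) i :
  monomial x (delta_mx 0 i) = x i.
Proof.
rewrite /monomial (bigD1 i) //= mxE !eqxx expr1z big1 ?mulr1 // => j ji.
by rewrite mxE eqxx (negPf ji) expr0z.
Qed.

Lemma pairing_delta (w : 'I_n -> int) i : pairing w (delta_mx 0 i) = w i.
Proof.
rewrite /pairing (bigD1 i) //= mxE !eqxx mulr1 big1 ?addr0 // => j ji.
by rewrite mxE eqxx (negPf ji) mulr0.
Qed.

Lemma primitive_weight (w : 'I_n -> nat) : J != finset.set0 ->
  (forall i, i \in J -> (0 < w i)%N) ->
  exists mu d, [/\ is_weight J mu, (0 < d)%N & forall i, i \in J -> w i = (mu i * d)%N].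
Proof.
move=> /set0Pn[i0 i0J] w0; pose d := \big[gcdn/0%N]_(i in J) w i.
have dw i : i \in J -> (d %| w i)%N by move=> iJ; rewrite /d (bigD1 i) //= dvdn_gcdl.
have d0 : (0 < d)%N by apply: dvdn_gt0 (w0 _ i0J) (dw _ i0J).
have wE i : i \in J -> w i = ((w i %/ d) * d)%N by move=> /dw /divnK.
exists (fun i => w i %/ d)%N, d; split => //; split.
  by move=> i iJ; rewrite divn_gt0 // dvdn_leq ?w0 ?dw.
apply/eqP; rewrite -(eqn_pmul2r d0) mul1n; apply/eqP.
rewrite (big_morph (muln^~ d) (fun a b => muln_gcdl a b d) (mul0n d)).
by rewrite {2}/d; apply: eq_bigr => i /wE.
Qed.

(** Dividing [f j] by its largest monomial and taking residues kills the
    infinitely small terms; what remains is the initial form for the weights of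
    [toric_specialization], evaluated at its torus point, up to a nonzero
    monomial factor. *)
Theorem degenerate_of_place (f : 'I_n -> {mpoly K[n]}) : J != finset.set0 ->
  (forall j, has (supported_in J) (msupp (f j)) ->
     exists m1, [/\ m1 \in msupp (f j), supported_in J m1 &
       G ((\sum_(m <- msupp (f j) | supported_in J m)
             sigma (f j)@_m * \prod_i y i ^+ m i) / \prod_i y i ^+ m1 i, 0)]) ->
  ~ bkk_nondegenerate J (fun j => restriction J (f j)).
Proof.
move=> J0 small.
have [[G1 GB GM Gfun] Gtot] := Gp.
pose ms := flatten [seq msupp (f j) | j <- enum 'I_n].
have msP j m : m \in msupp (f j) -> m \in ms.
  move=> mj; apply/flattenP; exists (msupp (f j)) => //.
  by apply/mapP; exists j; rewrite // mem_enum.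
pose E := [seq exponent m - exponent m' | m <- ms, m' <- ms] ++
  [seq (delta_mx 0 i : 'rV[int]_n) | i <- enum 'I_n].
have [w [x [x0 wx]]] := @toric_specialization _ _ _ _ y E Gp y_neq0.
have w0 i : i \in J -> 0 < w i.
  move=> iJ; have [|/(_ _) + _ _] := wx (delta_mx 0 i).
    by rewrite mem_cat; apply/orP; right; apply/mapP; exists i; rewrite ?mem_enum.
  by rewrite pairing_delta monomial_delta; apply; apply: yJ.
have [|mu [d [muJ d0 muE]]] := primitive_weight (w := fun i => absz (w i)) J0.
  by move=> i /w0 wi; rewrite absz_gt0 gt_eqF.
have pairingE m : supported_in J m ->
    pairing w (exponent m) = (mnm_weight J mu m * d)%N%:Z.
  move=> /supported_inP mJ; rewrite /mnm_weight big_distrl /=.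
  rewrite /pairing (bigID (mem J)) /= [X in _ + X]big1 ?addr0; last first.
    by move=> i iJ; rewrite mxE mJ ?mulr0.
  rewrite -[RHS]natz natr_sum; apply: eq_bigr => i iJ.
  by rewrite mxE intz natz mulnAC -muE // PoszM gtz0_abs ?w0.
have pairingB m m' : pairing w (exponent m - exponent m') =
    pairing w (exponent m) - pairing w (exponent m').
  by rewrite pairingD pairingN.
have d0' : 0 < d%:Z by rewrite ltz_nat.
move=> nondegenerate; apply: (nondegenerate mu muJ); exists x; split => // j.
have [fJ|fJ] := boolP (has (supported_in J) (msupp (f j))); last first.
  exact: initial_form_restriction_eval0.
have [m1 [m1j m1J]] := small j fJ; set theta := _ / _ => Gtheta.
have [m0 [m0j m0J m0min]] := lightest_supported mu fJ.
rewrite (initial_form_restriction_eval _ m0j m0J m0min).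
have inE2 m m' : m \in msupp (f j) -> m' \in msupp (f j) ->
    exponent m - exponent m' \in E.
  move=> mj mj'; rewrite mem_cat; apply/orP; left.
  by apply/allpairsP; exists (m, m'); split; [exact: msP mj | exact: msP mj' |].
have quotE (F : fieldType) (z : 'I_n -> F) m : (forall i, z i != 0) ->
    monomial z (exponent m - exponent m0) * \prod_i z i ^+ m0 i = \prod_i z i ^+ m i.
  by move=> z0; rewrite -!monomial_exponent -monomialD // subrK.
(* The residue of [f j] divided by the monomial of [m0]. *)
pose val := \sum_(m <- msupp (f j) | supported_in J m)
  (if mnm_weight J mu m == mnm_weight J mu m0
   then (f j)@_m * monomial x (exponent m - exponent m0) else 0).
have valE : \sum_(m <- msupp (f j) |
    supported_in J m && (mnm_weight J mu m == mnm_weight J mu m0))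
    (f j)@_m * \prod_i x i ^+ m i = val * \prod_i x i ^+ m0 i.
  rewrite /val -big_mkcondr mulr_suml; apply: eq_bigr => m _.
  by rewrite -mulrA quotE.
suff val0 : val = 0 by rewrite valE val0 mul0r.
pose theta0 := \sum_(m <- msupp (f j) | supported_in J m)
  sigma (f j)@_m * monomial y (exponent m - exponent m0).
have Gval : G (theta0, val).
  rewrite /theta0 /val [X in (X, _)]big_seq_cond [X in (_, X)]big_seq_cond.
  apply: place_sum => // m /andP[mj mJ].
  have [_ pos zero] := wx _ (inE2 _ _ mj m0j).
  have pE : pairing w (exponent m - exponent m0) =
      (mnm_weight J mu m - mnm_weight J mu m0)%N%:Z * d%:Z.
    by rewrite pairingB !pairingE // !PoszM -mulrBl subzn // m0min.
  case: ifPn => [/eqP mm0|nm].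
    by apply: GM => //; apply: zero; rewrite pE mm0 subnn mul0r.
  rewrite -(mulr0 (f j)@_m); apply: GM => //; apply: pos.
  by rewrite pE mulr_gt0 // ltz_nat subn_gt0 ltn_neqAle eq_sym nm m0min.
have theta0E : theta0 = theta * monomial y (exponent m1 - exponent m0).
  apply: (mulIf (monomial_neq0 (exponent m0) y_neq0)).
  rewrite monomial_exponent -mulrA quotE // /theta divfK; last first.
    by rewrite -monomial_exponent monomial_neq0.
  by rewrite mulr_suml; apply: eq_bigr => m _; rewrite -mulrA quotE.
have [c Gc] : exists c, G (monomial y (exponent m1 - exponent m0), c).
  have [_ pos zero] := wx _ (inE2 _ _ m1j m0j).
  have : 0 <= pairing w (exponent m1 - exponent m0).
    by rewrite pairingB !pairingE // subr_ge0 lez_nat leq_pmul2r // m0min.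
  rewrite le_eqVlt => /orP[/eqP/esym/zero|/pos] h; last by exists 0.
  by exists (monomial x (exponent m1 - exponent m0)).
apply: (place_fun Gp Gval).
by rewrite theta0E -(mul0r c); apply: GM.
Qed.

End DegenerateOfPlace.

(** * Degeneracy on a larger set of coordinates *)

Section LargerDegenerate.
Local Open Scope classical_set_scope.
Variables (K : closedFieldType) (n : nat) (f : 'I_n -> {mpoly K[n]}).
Variables (I : {set 'I_n}) (nu : 'I_n -> nat) (a : 'I_n -> K).
Hypotheses (nu_gt0 : forall i, i \in I -> (0 < nu i)%N) (a_neq0 : forall i, a i != 0).
Hypothesis common_zero :
  forall j, (initial_form I nu (restriction I (f j))).@[a] = 0.

Let meets j := has (supported_in I) (msupp (f j)).
Hypothesis many : (#|I| < #|[set j | meets j]%SET|)%N.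

Let N : nat := (\max_(j < n) \max_(m <- msupp (f j)) mnm_weight I nu m).+1.

Local Notation T := {mpoly {poly K}[n]}.

Let const : {rmorphism K -> T} := @mpolyC n {poly K} \o @polyC K.
Let t : T := ('X)%:MP.
(** The arc in the subspace of [I] given by the common zero [a], with the other
    coordinates deformed at order [N] in [t]. *)
Let arc (i : 'I_n) : T :=
  if i \in I then const (a i) * t ^+ nu i else t ^+ N * 'X_i.
Let along (p : {mpoly K[n]}) : T := mmap const arc p.

Let t_coef0 k : (t ^+ k)@_0%MM = 'X^k.
Proof. by rewrite -rmorphXn /= mcoeffC eqxx mulr1. Qed.

Let const_coef0 c : (const c)@_0%MM = c%:P.
Proof. by rewrite /const /= mcoeffC eqxx mulr1. Qed.

Let arc_supported m : supported_in I m ->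
  mmap1 arc m = const (\prod_i a i ^+ m i) * t ^+ mnm_weight I nu m.
Proof.
move=> /supported_inP mI.
rewrite /mnm_weight -prodrXr [X in _ * X]big_mkcond (rmorph_prod const).
rewrite -big_split /=; apply: eq_bigr => i _.
rewrite /arc; case: ifPn => [iI|/mI ->]; last by rewrite !expr0 rmorph1 mulr1.
by rewrite exprMn -exprM; congr (_ * _); apply/esym; exact: (rmorphXn const).
Qed.

Let arc_unsupported m : ~~ supported_in I m ->
  exists i b, i \notin I /\ mmap1 arc m = t ^+ N * ('X_i * b).
Proof.
rewrite negb_forall => /existsP[i]; rewrite negb_imply => /andP[iI mi].
exists i, (arc i ^+ (m i).-1 * \prod_(k | k != i) arc k ^+ m k); split => //.
rewrite /mmap1 (bigD1 i) //= mulrA -[in LHS](prednK (n := m i)) ?lt0n //.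
by rewrite exprS {1}/arc (negPf iI) !mulrA.
Qed.

(** Adjoining the variables of [I], which do not occur in the equations, gives a
    system in all [n] variables that still has fewer than [n] members. *)
Let S : seq T := [seq along (f j) | j in [set j | ~~ meets j]%SET] ++
  [seq ('X_i : T) | i in I].

Let size_S : (size S < n)%N.
Proof.
rewrite size_cat !size_map -!cardE -[ltnRHS](card_ord n).
rewrite -(cardsC [set j | meets j]) addnC.
have -> : (~: [set j | meets j] = [set j | ~~ meets j])%SET.
  by apply/setP => j; rewrite !inE.
by rewrite ltn_add2r.
Qed.

Let S_coef0 p : p \in S -> p@_0%MM = 0.
Proof.
rewrite mem_cat => /orP[] /mapP[j]; rewrite mem_enum ?inE => jS ->.
  rewrite /along /mmap big_seq raddf_sum big1 // => m /(hasPn jS) mI.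
  have [i [b [iI ->]]] := arc_unsupported mI.
  by rewrite /= !rmorphM /= mcoeffX mnm1_eq0 !(mul0r, mulr0).
by rewrite mcoeffX mnm1_eq0.
Qed.

(** [P] is the ideal of an irreducible variety through the generic point of the
    arc on which the equations hold and the coordinate [i0] is not identically 0. *)
Lemma variety_through_arc : exists i0 (P : set T),
  [/\ ideal_set P, (forall p, p \in S -> P p),
      (forall s r, s@_0%MM != 0 -> ~ P (s * 'X_i0 ^+ r)) &
      forall p q, P (p * q) -> P p \/ P q].
Proof.
(* Dimensions are counted over the function field of the arc. *)
pose phi : {rmorphism T -> {mpoly {fraction {poly K}}[n]}} :=
  map_mpoly (@tofrac {poly K}).
have [||i0 i0P] := @few_generators _ _ (map phi S).
- by rewrite size_map.
- by move=> _ /mapP[p pS ->]; rewrite /phi /= mcoeff_map_mpoly S_coef0.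
pose M := [set p : T | exists s r, s@_0%MM != 0 /\ p = s * 'X_i0 ^+ r].
have [|||p|P [Pideal SP MP Pprime]] := @prime_avoiding T (generated S) M.
- split; [exact: generated0 | move=> *; exact: generatedD | move=> *; exact: generatedM].
- by exists 1, 0%N; rewrite mcoeff1 eqxx oner_neq0 mulr1.
- move=> _ _ [s [r [s0 ->]]] [s' [r' [s'0 ->]]]; exists (s * s'), (r + r')%N.
  by rewrite rmorphM mulf_neq0 // exprD mulrACA.
- move=> [s [r [s0 ->]]] gen; apply: (i0P (phi s) r).
    by rewrite /phi /= mcoeff_map_mpoly tofrac_eq0.
  move=> k; exists (phi (s * 'X_i0 ^+ r)); first exact: generated_map.
  rewrite rmorphM rmorphXn /= /phi /= map_mpolyX subrr; exact: vanish0.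
exists i0, P; split => //.
- by move=> p pS; apply: SP; apply: mem_generated.
- by move=> s r s0; apply: MP; exists s, r.
Qed.

(** The terms of lowest order along the arc cancel because [a] is a zero of the
    initial form; terms with a variable outside [I] have order at least [N]. *)
Lemma along_divisible j m1 : m1 \in msupp (f j) -> supported_in I m1 ->
  (forall m, m \in msupp (f j) -> supported_in I m ->
     (mnm_weight I nu m1 <= mnm_weight I nu m)%N) ->
  exists b, along (f j) = t ^+ (mnm_weight I nu m1).+1 * b.
Proof.
move=> m1j m1I m1min; set w := mnm_weight I nu m1.
pose dvd p := exists b : T, p = t ^+ w.+1 * b.
have dvd0 : dvd 0 by exists 0; rewrite mulr0.
have dvdD p q : dvd p -> dvd q -> dvd (p + q).
  by move=> [b ->] [c ->]; exists (b + c); rewrite mulrDr.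
have dvdt k p : (w < k)%N -> dvd (t ^+ k * p).
  by move=> wk; exists (t ^+ (k - w.+1) * p); rewrite mulrA -exprD subnKC.
have dvdM c p : dvd p -> dvd (c * p).
  by move=> [b ->]; exists (c * b); rewrite mulrCA.
change (dvd (along (f j))); rewrite /along /mmap.
rewrite (bigID (fun m => supported_in I m && (mnm_weight I nu m == w))) /=.
apply: (dvdD).
  suff -> : \sum_(m <- msupp (f j) | supported_in I m && (mnm_weight I nu m == w))
      const (f j)@_m * mmap1 arc m = 0 by [].
  have := common_zero j; rewrite (initial_form_restriction_eval _ m1j m1I m1min) => z.
  transitivity (const 0 * t ^+ w); last by rewrite rmorph0 mul0r.
  rewrite -z (rmorph_sum const) mulr_suml; apply: eq_bigr => m /andP[mI /eqP <-].
  by rewrite arc_supported // mulrA -(rmorphM const).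
rewrite big_seq_cond; apply: big_ind; [exact: dvd0 | exact: (dvdD) |].
move=> m /andP[mj nm]; apply: dvdM.
have [mI|/arc_unsupported[i [b [_ ->]]]] := boolP (supported_in I m).
  rewrite arc_supported // mulrC; apply: dvdt.
  by move: nm; rewrite mI /= => nm; rewrite ltn_neqAle eq_sym nm m1min.
apply: dvdt; rewrite ltnS (bigD1 j) //=; apply: leq_trans (leq_maxl _ _).
exact: leq_bigmax_seq.
Qed.

(** The set [J] collects the coordinates that do not vanish on the variety of
    [variety_through_arc]. *)
Theorem larger_degenerate : exists J : {set 'I_n},
  I \proper J /\ ~ bkk_nondegenerate J (fun j => restriction J (f j)).
Proof.
have [i0 [P [Pideal PS Pi0 Pprime]]] := variety_through_arc.
have P0 p : p@_0%MM != 0 -> ~ P p.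
  by move=> p0; have := Pi0 p 0%N p0; rewrite mulr1.
have P1 : ~ P 1 by apply: P0; rewrite mcoeff1 eqxx oner_neq0.
have [L [pi piP]] := field_of_prime Pideal P1 Pprime.
(* The specialization to the origin of the arc. *)
pose ev : {rmorphism T -> K} := horner_eval 0 \o mcoeff 0%MM.
have [||G [Gp Gpi]] := @place_extension L K T pi ev const.
- by move=> c; rewrite /ev /= /horner_eval mcoeffC eqxx mulr1 hornerC.
- move=> p /piP Pp; rewrite /ev /= /horner_eval.
  have [->|/P0 //] := eqVneq (p@_0%MM) 0; exact: horner0.
have pi_neq0 p : p@_0%MM != 0 -> pi p != 0.
  by move=> /P0 nP; apply/eqP => /piP.
have pi_t k : pi (t ^+ k) != 0 by apply: pi_neq0; rewrite t_coef0 monic_neq0 ?monicXn.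
pose J := (I :|: [set i | pi 'X_i != 0])%SET.
have IJ m : supported_in I m -> supported_in J m.
  move=> /supported_inP mI; apply/supported_inP => i; rewrite inE negb_or.
  by case/andP => /mI.
have piX i : i \in I -> pi 'X_i = 0.
  move=> iI; apply/piP/PS; rewrite mem_cat; apply/orP; right.
  by apply/mapP; exists i; rewrite // mem_enum.
have i0J : pi 'X_i0 != 0.
  apply/eqP => /piP; have := Pi0 1 1%N; rewrite mcoeff1 eqxx oner_neq0 mul1r.
  by apply.
exists J; split.
  apply/properP; split; first exact: finset.subsetUl.
  exists i0; first by rewrite !inE i0J orbT.
  by apply: contra i0J => /piX ->.
pose y i := if i \in J then pi (arc i) else 1.
have arc_out i : i \notin J -> pi (arc i) = 0.
  rewrite !inE negb_or negbK /arc => /andP[/negPf -> /eqP Xi].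
  by rewrite rmorphM Xi mulr0.
have y0 i : y i != 0.
  rewrite /y; case: ifP => [|_]; last exact: oner_neq0.
  rewrite !inE /arc; case: ifP => [iI _|iI /= Xi]; last by rewrite rmorphM mulf_neq0.
  apply: pi_neq0; rewrite rmorphM /= t_coef0 const_coef0 mulf_neq0 //.
    by rewrite polyC_eq0.
  by rewrite monic_neq0 ?monicXn.
have ev_t k : (0 < k)%N -> ev (t ^+ k) = 0.
  by move=> k0; rewrite /ev /= t_coef0 /horner_eval hornerXn expr0n gtn_eqF.
have yJ i : i \in J -> G (y i, 0).
  move=> iJ; rewrite /y iJ; suff <- : ev (arc i) = 0 by apply: Gpi.
  rewrite /arc; case: ifP => [iI|_]; first by rewrite rmorphM ev_t ?mulr0 ?nu_gt0.
  by rewrite rmorphM ev_t ?mul0r.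
have pi_mmap1 m : pi (mmap1 arc m) =
    if supported_in J m then \prod_i y i ^+ m i else 0.
  rewrite rmorph_prod; case: ifPn => [/supported_inP mJ|].
    apply: eq_bigr => i _; rewrite rmorphXn /y.
    by case: ifPn => // /mJ ->; rewrite !expr0.
  rewrite negb_forall => /existsP[i]; rewrite negb_imply => /andP[iJ mi].
  by rewrite (bigD1 i) //= rmorphXn /= arc_out // expr0n (negPf mi) mul0r.
have pi_along p : pi (along p) =
    \sum_(m <- msupp p | supported_in J m) pi (const p@_m) * \prod_i y i ^+ m i.
  rewrite rmorph_sum [RHS]big_mkcond; apply: eq_bigr => m _.
  by rewrite rmorphM pi_mmap1; case: ifP; rewrite ?mulr0.
have J0 : J != finset.set0 by apply/set0Pn; exists i0; rewrite !inE i0J orbT.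
apply: (@degenerate_of_place L K n G (pi \o const) Gp _ J y) => //.
  move=> c; have := Gpi (const c); congr (G (_, _)).
  by rewrite /ev /= const_coef0 /horner_eval hornerC.
move=> j fJ.
suff [m1 [m1j m1J Gm1]] : exists m1, [/\ m1 \in msupp (f j), supported_in J m1 &
    G (pi (along (f j)) / \prod_i y i ^+ m1 i, 0)].
  by exists m1; split => //; move: Gm1; rewrite pi_along => Gm1; exact: Gm1.
have [fI|fI] := boolP (meets j); last first.
  have [m1 m1j m1J] := hasP fJ; exists m1; split => //.
  rewrite (_ : pi _ = 0) ?mul0r; first by have := Gpi 0; rewrite !rmorph0.
  apply/piP/PS; rewrite mem_cat; apply/orP; left; apply/mapP; exists j => //.
  by rewrite mem_enum inE.
have [m1 [m1j m1I m1min]] := lightest_supported nu fI.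
have [b bE] := along_divisible m1j m1I m1min.
exists m1; split => //; first exact: IJ.
pose c := \prod_i a i ^+ m1 i.
have c0 : c != 0 by apply/prodf_neq0 => i _; rewrite expf_neq0.
have := pi_mmap1 m1; rewrite IJ // => <-.
rewrite bE arc_supported // -/c.
have -> : pi (t ^+ (mnm_weight I nu m1).+1 * b) /
    pi (const c * t ^+ mnm_weight I nu m1) = pi (t ^+ 1 * (b * const c^-1)).
  have nz : pi (const c * t ^+ mnm_weight I nu m1) != 0.
    by rewrite rmorphM mulf_neq0 // pi_neq0 // const_coef0 polyC_eq0.
  apply: (mulIf nz); rewrite divfK // -rmorphM; congr (pi _).
  have cc : const c^-1 * const c = 1 by rewrite -rmorphM mulVf // rmorph1.
  transitivity (t ^+ (mnm_weight I nu m1).+1 * b * (const c^-1 * const c)).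
    by rewrite cc mulr1.
  by rewrite exprS; ring.
by rewrite -(mul0r (ev (b * const c^-1))) -(ev_t 1%N) // -rmorphM; apply: Gpi.
Qed.

End LargerDegenerate.

(** * The equivalence *)

Lemma supported_in_set0 n (m : 'X_{1..n}) : supported_in finset.set0 m = (m == 0%MM).
Proof.
apply/supported_inP/eqP => [m0|-> i _]; last exact: mnm0E.
by apply/mnmP => i; rewrite mnm0E m0 ?inE.
Qed.

Lemma has_constant_term (K : closedFieldType) n (p : {mpoly K[n]}) :
  has (supported_in finset.set0) (msupp p) = (p@_0%MM != 0).
Proof.
rewrite -mcoeff_msupp; apply/hasP/idP => [[m mp]|p0].
  by rewrite supported_in_set0 => /eqP <-.
by exists 0%MM; rewrite ?supported_in_set0.
Qed.

(** A nonzero constant term is the whole initial form for any positive weight. *)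
Lemma constant_term_of_degenerate (K : closedFieldType) n (I : {set 'I_n})
    (nu : 'I_n -> nat) (p : {mpoly K[n]}) (a : 'I_n -> K) :
  (forall i, i \in I -> (0 < nu i)%N) ->
  (initial_form I nu (restriction I p)).@[a] = 0 -> p@_0%MM = 0.
Proof.
move=> nu0; apply: contra_eq => p0.
have p0' : 0%MM \in msupp p by rewrite mcoeff_msupp.
have wt0 : mnm_weight I nu 0%MM = 0%N.
  by rewrite /mnm_weight big1 // => i _; rewrite mnm0E muln0.
rewrite (@initial_form_restriction_eval _ _ _ _ _ _ 0%MM) ?wt0 //; last first.
  by apply/supported_inP => i _; rewrite mnm0E.
have sup0 : supported_in I 0%MM by apply/supported_inP => i _; rewrite mnm0E.
rewrite big_mkcond (bigD1_seq 0%MM) ?msupp_uniq //= sup0 wt0 eqxx /=.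
rewrite big1 ?mulr1 => [|i _]; last by rewrite mnm0E expr0.
rewrite big1 ?addr0 // => m m0; case: ifP => // /andP[/supported_inP mI].
rewrite sum_nat_eq0 => /forallP wt; case/eqP: m0; apply/mnmP => i.
rewrite mnm0E; have [iI|/mI //] := boolP (i \in I).
have /implyP/(_ iI) := wt i.
by rewrite muln_eq0 -leqn0 leqNgt nu0 //= => /eqP.
Qed.

Theorem lemma4p14 (K : closedFieldType) (R : realType) (n : nat) (hn : (1 <= n)%N)
    (Gamma : 'I_n -> set 'rV[R]_n)
    (hGamma : forall j, is_diagram K (Gamma j))
    (hfin : (mult0 K Gamma < +oo)%E)
    (f : 'I_n -> {mpoly K[n]})
    (hf : forall j, newton_diagram (f j) = Gamma j) :
  (forall I : {set 'I_n}, I != finset.set0 ->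
     bkk_nondegenerate I (fun j => restriction I (f j))) <->
  (forall I : {set 'I_n}, I \in calN Gamma ->
     bkk_nondegenerate I (fun j => restriction I (f j))).
Proof.
split=> [H I|H].
  by rewrite inE => /andP[I0 _]; apply: H.
have [g [gGamma [d [e basis]]]] := finite_mult0 hfin.
have meetsE I j : has (supported_in I) (msupp (f j)) = has (supported_in I) (msupp (g j)).
  have h1 := newton_diagram_meets R I (f j); rewrite hf in h1.
  have h2 := newton_diagram_meets R I (g j); rewrite gGamma in h2.
  by apply/idP/idP => [/h1/h2 | /h2/h1].
have calNIE I : calNI Gamma I = [set j | has (supported_in I) (msupp (f j))]%SET.
  apply/setP => j; rewrite !inE; apply/asboolP/idP;
  by rewrite -hf newton_diagram_meets.
move=> I; have [k] := ubnP (n - #|I|); elim: k I => // k IH I Ik I0.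
have [/H //|notN] := boolP (I \in calN Gamma).
move=> nu [nu0 _] [a [a0 zero]].
have f0 j : (f j)@_0%MM = 0 := constant_term_of_degenerate nu0 (zero j).
have g0 j : (g j)@_0%MM = 0.
  by apply/eqP; have := has_constant_term (g j); rewrite -meetsE has_constant_term f0
    eqxx => /esym/negbFE.
have many : (#|I| < #|[set j | has (supported_in I) (msupp (f j))]%SET|)%N.
  have le := enough_equations I basis g0; rewrite ltn_neqAle.
  move: notN; rewrite !inE I0 /= calNIE eq_sym => -> /=.
  by rewrite (leq_trans le) // subset_leq_card //; apply/fintype.subsetP => j;
    rewrite !inE meetsE.
have [J [IJ]] := larger_degenerate nu0 a0 zero many.
apply; apply: IH; last first.
  by apply: contraTneq IJ => ->; rewrite properE finset.subset0 (negPf I0).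
have IJc := proper_card IJ.
have Jn : (#|J| <= n)%N by rewrite -[leqRHS](card_ord n) max_card.
by move: Ik; rewrite !ltnS; apply: leq_trans; rewrite ltn_sub2l // (leq_trans IJc).
Qed.
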